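(* Let $H$ be a graph. If Matching Cut is polynomial-time solvable for $H$-free graphs, then it is so for $(H+P_3)$-free graphs.
   Context: Matching Cut is the decision problem: given a connected graph $G$, does $G$ have a matching cut (a matching $M$ such that $G-M$ is disconnected)? $H+P_3$ denotes the disjoint union of $H$ and the path $P_3$ on three vertices; a graph is $H$-free if it contains no induced subgraph isomorphic to $H$. *)

(* Defs.v *)
From mathcomp Require Import all_boot.

Set Implicit Arguments.
Unset Strict Implicit.
Unset Printing Implicit Defensive.

Record sgraph (V : finType) := SGraph {
  adj :> rel V;
  adj_sym : symmetric adj;
  adj_irr : irreflexive adj
}.

Definition isomorphic (V W : finType) (G : sgraph V) (H : sgraph W) : Prop :=
  exists f : V -> W, bijective f /\ forall x y, H (f x) (f y) = G x y.

Section Induced.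
Variables (V : finType) (G : sgraph V) (S : {set V}).

Definition induced_adj : rel {x : V | x \in S} := fun x y => G (val x) (val y).

Lemma induced_sym : symmetric induced_adj.
Proof. by move=> x y; apply: adj_sym. Qed.

Lemma induced_irr : irreflexive induced_adj.
Proof. by move=> x; apply: adj_irr. Qed.

Definition induced : sgraph {x : V | x \in S} :=
  SGraph induced_sym induced_irr.
End Induced.

Definition induced_free (W V : finType) (H : sgraph W) (G : sgraph V) : Prop :=
  ~ exists S : {set V}, isomorphic (induced G S) H.

Section DisjointUnion.
Variables (V W : finType) (G : sgraph V) (H : sgraph W).

Definition dunion_adj : rel (V + W)%type := fun a b =>
  match a, b with
  | inl x, inl y => G x y
  | inr x, inr y => H x y
  | _, _ => false
  end.

Lemma dunion_sym : symmetric dunion_adj.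
Proof. by case=> x [] y //=; apply: adj_sym. Qed.

Lemma dunion_irr : irreflexive dunion_adj.
Proof. by case=> x /=; apply: adj_irr. Qed.

Definition dunion : sgraph (V + W)%type := SGraph dunion_sym dunion_irr.
End DisjointUnion.

Section PathGraph.
Variable n : nat.

Definition path_adj : rel 'I_n :=
  fun i j => (i.+1 == j :> nat) || (j.+1 == i :> nat).

Lemma path_sym : symmetric path_adj.
Proof. by move=> i j; apply: orbC. Qed.

Lemma path_irr : irreflexive path_adj.
Proof. by move=> i; rewrite /path_adj orbb gtn_eqF. Qed.

Definition path_graph : sgraph 'I_n := SGraph path_sym path_irr.
End PathGraph.

Definition connected (V : finType) (G : sgraph V) : bool :=
  [forall x, forall y, connect G x y].

(* An edge is the two-element set of its ends. *)
Definition edges (V : finType) (G : sgraph V) : {set {set V}} :=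
  [set e | [exists x, exists y, G x y && (e == [set x; y])]].

Definition matching (V : finType) (G : sgraph V) (M : {set {set V}}) : bool :=
  (M \subset edges G) && trivIset M.

Section DeleteEdges.
Variables (V : finType) (G : sgraph V) (M : {set {set V}}).

Definition delete_adj : rel V := fun x y => G x y && ([set x; y] \notin M).

Lemma delete_sym : symmetric delete_adj.
Proof. by move=> x y; rewrite /delete_adj adj_sym setUC. Qed.

Lemma delete_irr : irreflexive delete_adj.
Proof. by move=> x; rewrite /delete_adj adj_irr. Qed.

Definition delete_edges : sgraph V := SGraph delete_sym delete_irr.
End DeleteEdges.

Definition has_matching_cut (V : finType) (G : sgraph V) : bool :=
  [exists M : {set {set V}}, matching G M && ~~ connected (delete_edges G M)].

(* The unit-cost RAM with addition and truncated subtraction (no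
   multiplication), registers r_0, r_1, ... holding natural numbers, and a
   read-only input w.  Register contents grow by at most one bit per step, so
   its polynomial time is that of Turing machines. *)
Inductive instr :=
| IConst of nat & nat       (* IConst i c   : r_i := c *)
| IAdd of nat & nat & nat   (* IAdd i j k   : r_i := r_j + r_k *)
| ISub of nat & nat & nat   (* ISub i j k   : r_i := r_j - r_k *)
| ILoad of nat & nat        (* ILoad i j    : r_i := r_(r_j) *)
| IStore of nat & nat       (* IStore i j   : r_(r_i) := r_j *)
| IRead of nat & nat        (* IRead i j    : r_i := w_(r_j), 0 past the end *)
| IJumpPos of nat & nat     (* IJumpPos i l : if 0 < r_i then go to l *)
| IHalt.

Definition program := seq instr.

Definition memory := nat -> nat.

Definition upd (m : memory) (i v : nat) : memory :=
  fun j => if j == i then v else m j.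

Definition config := (nat * memory)%type.

(* Leaving the program is halting. *)
Definition fetch (P : program) (s : config) : instr := nth IHalt P s.1.

Definition step (P : program) (w : seq nat) (s : config) : config :=
  let: (pc, m) := s in
  match fetch P s with
  | IConst i c => (pc.+1, upd m i c)
  | IAdd i j k => (pc.+1, upd m i (m j + m k))
  | ISub i j k => (pc.+1, upd m i (m j - m k))
  | ILoad i j => (pc.+1, upd m i (m (m j)))
  | IStore i j => (pc.+1, upd m (m i) (m j))
  | IRead i j => (pc.+1, upd m i (nth 0 w (m j)))
  | IJumpPos i l => (if 0 < m i then l else pc.+1, m)
  | IHalt => s
  end.

Definition run (P : program) (w : seq nat) (t : nat) : config :=
  iter t (step P w) (0, fun=> 0).

Definition halted (P : program) (s : config) : Prop := fetch P s = IHalt.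

(* The answer is yes when r_0 is positive at the halt. *)
Definition answers (P : program) (w : seq nat) (t : nat) (b : bool) : Prop :=
  halted P (run P w t) /\ (0 < (run P w t).2 0) = b.

(* The number of vertices, followed by the adjacency matrix row by row. *)
Definition encode (n : nat) (G : sgraph 'I_n) : seq nat :=
  n :: [seq nat_of_bool (G x y) | x <- enum 'I_n, y <- enum 'I_n].

Definition graph_class := forall n : nat, sgraph 'I_n -> Prop.

Definition free_class (W : finType) (H : sgraph W) : graph_class :=
  fun n G => induced_free H G.

(* Instances are the connected graphs of the class, on vertex set
   {0, ..., n-1} with every labelling. *)
Definition matching_cut_poly_time (C : graph_class) : Prop :=
  exists (P : program) (c k : nat), forall (n : nat) (G : sgraph 'I_n),
    connected G -> C n G ->
    exists t : nat, t <= c * size (encode G) ^ k + c /\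
      answers P (encode G) t (has_matching_cut G).

(* Main.v *)
Require Import Defs.
From mathcomp Require Import all_boot.
From mathcomp Require Import zify.
From Stdlib Require Import FunctionalExtensionality.

Set Implicit Arguments.
Unset Strict Implicit.
Unset Printing Implicit Defensive.

(** A matching cut is a 2-colouring using both colours in which every vertex has
    at most one neighbour of the other colour.  If an [(H + P_3)]-free graph [G]
    is [H]-free, the given algorithm applies.  Otherwise search for a copy [D]
    of [H] in [G] and guess, for each vertex of [D], its colour and its only
    neighbour of the other colour, together with two vertices of different
    colours: polynomially many guesses, since [H] is fixed.  A guess colours
    [N[D]], and [G - N[D]] is [P_3]-free, so the condition on a vertex and two
    of its neighbours either involves an already coloured vertex, hence is a
    2-clause, or concerns a triangle, which must be monochromatic.  What remains
    is 2-SAT, decided by reachability in the implication graph.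

    The RAM program is written in a language of expressions and commands whose
    only loops run over [0, ..., n - 1]; every program of that language is
    therefore polynomial, and its meaning is a plain function. *)

(** * Execution of RAM code *)

(** The given program promises nothing on graphs that contain [H]: it may answer wrongly there or
    never halt. The new program must therefore settle by itself whether [H] occurs before it
    delegates, and the given program must then find a blank memory. This shapes the two languages:
    the search is a pure expression, which dirties only a list of scratch registers known in
    advance, zeroed by constant code; commands, which also fill variables and an array, occur only
    on the branch that never delegates. A guess may be wrong without harm: as soon as [d] is an
    embedding into an [(H + P_3)]-free graph, the clauses imply the cut condition, so a satisfiable
    guess always yields a cut. Conversely the guess read off an actual cut is among those tried. Two
    vertices of different colours are part of the guess because the use of both colours is not a
    2-clause. *)

Definition code_at (P : program) (pc : nat) (c : program) : Prop :=
  forall i, i < size c -> nth IHalt P (pc + i) = nth IHalt c i.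

Lemma code_at_cat P pc c1 c2 :
  code_at P pc (c1 ++ c2) -> code_at P pc c1 /\ code_at P (pc + size c1) c2.
Proof.
move=> h; split=> i hi.
  by rewrite h ?nth_cat ?hi // size_cat ltn_addr.
rewrite -addnA h; last by rewrite size_cat ltn_add2l.
by rewrite nth_cat ltnNge leq_addr /= addKn.
Qed.

Lemma code_at_cons P pc i c :
  code_at P pc (i :: c) -> nth IHalt P pc = i /\ code_at P pc.+1 c.
Proof.
move=> h; split; first by have := h 0 isT; rewrite addn0.
by move=> j hj; rewrite addSnnS h.
Qed.

Lemma code_at_mid (c1 c c2 : program) : code_at (c1 ++ c ++ c2) (size c1) c.
Proof.
move=> i hi.
by rewrite nth_cat ltnNge leq_addr /= addKn nth_cat hi.
Qed.

Section Execution.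
Variables (P : program) (w : seq nat).

Definition reaches (T : nat) (s s' : config) : Prop :=
  exists2 t, t <= T & iter t (step P w) s = s'.

Lemma reaches_refl s : reaches 0 s s.
Proof. by exists 0. Qed.

Lemma reaches_trans T1 T2 s1 s2 s3 :
  reaches T1 s1 s2 -> reaches T2 s2 s3 -> reaches (T1 + T2) s1 s3.
Proof.
move=> [t1 h1 e1] [t2 h2 e2]; exists (t2 + t1); first by rewrite addnC leq_add.
by rewrite iterD e1.
Qed.

Lemma reaches_le T1 T2 s s' : T1 <= T2 -> reaches T1 s s' -> reaches T2 s s'.
Proof. by move=> h [t ht e]; exists t => //; apply: leq_trans h. Qed.

Definition effect (i : instr) (m : memory) : memory := (step [:: i] w (0, m)).2.

Definition straight (i : instr) : bool :=
  match i with IJumpPos _ _ | IHalt => false | _ => true end.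

Lemma reaches_straight pc c m : code_at P pc c -> all straight c ->
  reaches (size c) (pc, m) (pc + size c, foldl (fun m i => effect i m) m c).
Proof.
elim: c pc m => [|i c IH] pc m /=.
  by move=> _ _; rewrite addn0; apply: reaches_refl.
move=> /code_at_cons [hi hc] /andP [si sc].
rewrite -add1n addnA addn1; apply: reaches_trans (IH _ _ hc sc).
exists 1 => //=; rewrite /fetch /= hi.
by case: i si {hi}.
Qed.

Lemma reaches_jump pc i l m :
  nth IHalt P pc = IJumpPos i l ->
  reaches 1 (pc, m) (if 0 < m i then l else pc.+1, m).
Proof. by move=> h; exists 1 => //=; rewrite /fetch /= h. Qed.

(** Compiled loops have their test at the bottom and enter through it, so [Inv k] describes the
    moment when [k] rounds remain, the content of register [r]. A round costs its body and one jump;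
    the final [+ 1] pays for the failing test. *)
Lemma reaches_loop body test r T (Inv : nat -> memory -> Prop) :
  nth IHalt P test = IJumpPos r body ->
  (forall k m, Inv k m -> m r = k) ->
  (forall k m, Inv k.+1 m ->
     exists2 m', reaches T (body, m) (test, m') & Inv k m') ->
  forall k m, Inv k m ->
  exists2 m', reaches (k * T.+1 + 1) (test, m) (test.+1, m') & Inv 0 m'.
Proof.
move=> htest hr hbody; elim=> [|k IH] m hm; have := reaches_jump m htest;
  rewrite (hr _ _ hm) /= => hj.
  by exists m.
have [m1 h1 i1] := hbody _ _ hm; have [m2 h2 i2] := IH _ i1.
exists m2 => //; apply: reaches_le (reaches_trans hj (reaches_trans h1 h2)).
by rewrite mulSn; lia.
Qed.

End Execution.

(** * Compilation of expressions *)

(* Registers are sorted by their residue modulo 3, so that program variables,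
   scratch registers and the cells of the array never collide. *)
Definition rN := 0.
Definition rOne := 3.
Definition rZero := 6.
Definition var (x : nat) := 3 * x + 1.
Definition scr (d : nat) := 3 * d + 2.
Definition cell (a : nat) := 3 * a + 9.

Definition vars (m : memory) : nat -> nat := fun x => m (var x).
Definition cells (m : memory) : nat -> nat := fun a => m (cell a).

(** The machine has no copy instruction; compiled code never writes to [rZero], which stays 0. *)
Definition mov (i j : nat) := IAdd i j rZero.

Inductive exp :=
| EN
| EVar of nat
| EConst of nat
| EAdd of exp & exp
| ESub of exp & exp
| ERead of exp
| ELoad of exp
| ESum of nat & exp.

Fixpoint eval (w : seq nat) (n : nat) (v a : nat -> nat) (e : exp) : nat :=
  match e with
  | EN => n
  | EVar x => v x
  | EConst c => c
  | EAdd e1 e2 => eval w n v a e1 + eval w n v a e2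
  | ESub e1 e2 => eval w n v a e1 - eval w n v a e2
  | ERead e => nth 0 w (eval w n v a e)
  | ELoad e => a (eval w n v a e)
  | ESum x e => \sum_(0 <= k < n) eval w n (upd v x k) a e
  end.

(** Jumps are absolute, hence the argument [pc]; the value is left in [scr d], and only scratch
    registers from [d] on are free. [ELoad] forms the address [3 * a + 9] of [cell a] by additions.
    In [ESum], [scr d] accumulates, [scr d.+1] counts down and [scr d.+2] saves the outer value of
    [x]; the jump on [rOne] is unconditional and leads to the bottom test, so [n = 0] runs no
    round. *)
Fixpoint compe (e : exp) (d pc : nat) : program :=
  match e with
  | EN => [:: mov (scr d) rN]
  | EVar x => [:: mov (scr d) (var x)]
  | EConst c => [:: IConst (scr d) c]
  | EAdd e1 e2 =>
      let c1 := compe e1 d pc in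
      c1 ++ compe e2 d.+1 (pc + size c1) ++ [:: IAdd (scr d) (scr d) (scr d.+1)]
  | ESub e1 e2 =>
      let c1 := compe e1 d pc in
      c1 ++ compe e2 d.+1 (pc + size c1) ++ [:: ISub (scr d) (scr d) (scr d.+1)]
  | ERead e => compe e d pc ++ [:: IRead (scr d) (scr d)]
  | ELoad e =>
      compe e d pc ++
      [:: IAdd (scr d.+1) (scr d) (scr d); IAdd (scr d) (scr d) (scr d.+1);
          IConst (scr d.+1) 9; IAdd (scr d) (scr d) (scr d.+1);
          ILoad (scr d) (scr d)]
  | ESum x e =>
      let c := compe e (d + 3) (pc + 6) in
      [:: IConst (scr d) 0; mov (scr d.+1) rN; mov (scr d.+2) (var x)] ++
      [:: IJumpPos rOne (pc + 7 + size c)] ++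
      [:: ISub (scr d.+1) (scr d.+1) rOne; mov (var x) (scr d.+1)] ++
      c ++
      [:: IAdd (scr d) (scr d) (scr (d + 3))] ++
      [:: IJumpPos (scr d.+1) (pc + 4)] ++ [:: mov (var x) (scr d.+2)]
  end.

Fixpoint cost (e : exp) (n : nat) : nat :=
  match e with
  | EN | EVar _ | EConst _ => 1
  | EAdd e1 e2 | ESub e1 e2 => cost e1 n + cost e2 n + 1
  | ERead e => cost e n + 1
  | ELoad e => cost e n + 5
  | ESum _ e => n * (cost e n + 4) + 6
  end.

(** A bound that depends on the syntax alone: it makes the registers dirtied by an expression a
    fixed list, which fixed code can zero again. *)
Fixpoint width (e : exp) : nat :=
  match e with
  | EN | EVar _ | EConst _ => 1
  | EAdd e1 e2 | ESub e1 e2 => maxn (width e1) (width e2).+1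
  | ERead e => width e
  | ELoad e => maxn (width e) 2
  | ESum _ e => width e + 3
  end.

Definition agree (d k : nat) (m m' : memory) : Prop :=
  forall r, (forall j, d <= j < d + k -> r != scr j) -> m' r = m r.

Lemma scr_inj j k : (scr j == scr k) = (j == k).
Proof. by rewrite /scr; lia. Qed.

Lemma agree_base d k m m' : agree d k m m' ->
  [/\ m' rN = m rN, m' rOne = m rOne & m' rZero = m rZero].
Proof. by move=> h; split; apply: h => j _; rewrite /rN /rOne /rZero /scr; lia. Qed.

Lemma agree_vars d k m m' : agree d k m m' -> vars m' = vars m.
Proof.
move=> h; apply: functional_extensionality => x; apply: h => j _.
by rewrite /var /scr; lia.
Qed.

Lemma agree_cells d k m m' : agree d k m m' -> cells m' = cells m.
Proof.
move=> h; apply: functional_extensionality => x; apply: h => j _.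
by rewrite /cell /scr; lia.
Qed.

Lemma agree_scr d k m m' j : agree d k m m' -> j < d -> m' (scr j) = m (scr j).
Proof. by move=> h hj; apply: h => i hi; rewrite scr_inj; lia. Qed.

Lemma agree_upd d k m m' j v : d <= j < d + k ->
  agree d k m m' -> agree d k m (upd m' (scr j) v).
Proof. by move=> hj h r hr; rewrite /upd (negbTE (hr _ hj)) h. Qed.

Lemma agree_trans d1 k1 d2 k2 d k m1 m2 m3 :
  agree d1 k1 m1 m2 -> agree d2 k2 m2 m3 ->
  d <= d1 -> d <= d2 -> d1 + k1 <= d + k -> d2 + k2 <= d + k -> agree d k m1 m3.
Proof.
move=> h1 h2 ? ? ? ? r hr; rewrite h2 ?h1 // => j hj; apply: hr; lia.
Qed.

Lemma agree_refl d k m : agree d k m m.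
Proof. by []. Qed.

Lemma vars_upd_var m x v : vars (upd m (var x) v) = upd (vars m) x v.
Proof.
apply: functional_extensionality => y; rewrite /vars /upd.
by congr (if _ then _ else _); rewrite /var; lia.
Qed.

Lemma cells_upd_var m x v : cells (upd m (var x) v) = cells m.
Proof.
apply: functional_extensionality => y; rewrite /cells /upd ifF //.
by rewrite /var /cell; lia.
Qed.

Lemma cells_upd_cell m x v : cells (upd m (cell x) v) = upd (cells m) x v.
Proof.
apply: functional_extensionality => y; rewrite /cells /upd.
by congr (if _ then _ else _); rewrite /cell; lia.
Qed.

Lemma vars_upd_cell m x v : vars (upd m (cell x) v) = vars m.
Proof.
apply: functional_extensionality => y; rewrite /vars /upd ifF //.
by rewrite /var /cell; lia.
Qed.

Lemma upd_same m i v : upd m i v i = v.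
Proof. by rewrite /upd eqxx. Qed.

Lemma upd_neq m i v j : j != i -> upd m i v j = m j.
Proof. by rewrite /upd => /negbTE ->. Qed.

Lemma width_gt0 e : 0 < width e.
Proof. elim: e => //= *; lia. Qed.

Ltac regs := rewrite /scr /var /cell /rN /rOne /rZero; lia.
Ltac upds := rewrite ?upd_same; repeat (rewrite upd_neq; [rewrite ?upd_same | by regs]).

Section CompileCorrect.
Variables (P : program) (w : seq nat).

Lemma compe_correct e : forall d pc m,
  code_at P pc (compe e d pc) -> m rOne = 1 -> m rZero = 0 ->
  exists m', [/\ reaches P w (cost e (m rN)) (pc, m) (pc + size (compe e d pc), m'),
    m' (scr d) = eval w (m rN) (vars m) (cells m) e & agree d (width e) m m'].
Proof.
elim: e => [|x|c|e1 IH1 e2 IH2|e1 IH1 e2 IH2|e IH|e IH|x e IH] d pc m hc h1 h0.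
- exists (upd m (scr d) (m rN + m rZero)); split.
  + exact: (reaches_straight w m hc).
  + by rewrite upd_same h0 addn0.
  + by apply: agree_upd => //=; lia.
- exists (upd m (scr d) (m (var x) + m rZero)); split.
  + exact: (reaches_straight w m hc).
  + by rewrite upd_same h0 addn0.
  + by apply: agree_upd => //=; lia.
- exists (upd m (scr d) c); split.
  + exact: (reaches_straight w m hc).
  + by rewrite upd_same.
  + by apply: agree_upd => //=; lia.
- move: hc => /= /code_at_cat [hc1 /code_at_cat [hc2 hc3]].
  have [m1 [r1 v1 a1]] := IH1 _ _ _ hc1 h1 h0.
  have [eN eO eZ] := agree_base a1.
  have [|| m2 [r2 v2 a2]] := IH2 _ _ m1 hc2; rewrite ?eO ?eZ //.
  exists (upd m2 (scr d) (m2 (scr d) + m2 (scr d.+1))); split.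
  + have := reaches_straight w m2 hc3 isT.
    move=> /(reaches_trans r2) /(reaches_trans r1).
    by rewrite eN /= !size_cat /= !addnA.
  + by rewrite upd_same v2 (agree_scr a2) // v1 eN (agree_vars a1) (agree_cells a1).
  + apply: agree_upd; first by have := width_gt0 e1; lia.
    by apply: agree_trans a1 a2 _ _ _ _; lia.
- move: hc => /= /code_at_cat [hc1 /code_at_cat [hc2 hc3]].
  have [m1 [r1 v1 a1]] := IH1 _ _ _ hc1 h1 h0.
  have [eN eO eZ] := agree_base a1.
  have [|| m2 [r2 v2 a2]] := IH2 _ _ m1 hc2; rewrite ?eO ?eZ //.
  exists (upd m2 (scr d) (m2 (scr d) - m2 (scr d.+1))); split.
  + have := reaches_straight w m2 hc3 isT.
    move=> /(reaches_trans r2) /(reaches_trans r1).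
    by rewrite eN /= !size_cat /= !addnA.
  + by rewrite upd_same v2 (agree_scr a2) // v1 eN (agree_vars a1) (agree_cells a1).
  + apply: agree_upd; first by have := width_gt0 e1; lia.
    by apply: agree_trans a1 a2 _ _ _ _; lia.
- move: hc => /= /code_at_cat [hc1 hc2].
  have [m1 [r1 v1 a1]] := IH _ _ _ hc1 h1 h0.
  exists (upd m1 (scr d) (nth 0 w (m1 (scr d)))); split.
  + have := reaches_straight w m1 hc2 isT.
    by move=> /(reaches_trans r1); rewrite size_cat !addnA.
  + by rewrite upd_same v1.
  + by apply: agree_upd => //; have := width_gt0 e; lia.
- move: hc => /= /code_at_cat [hc1 hc2].
  have [m1 [r1 v1 a1]] := IH _ _ _ hc1 h1 h0.
  have := reaches_straight w m1 hc2 isT; move=> /(reaches_trans r1) /=.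
  rewrite /effect /=; set m2 := (X in reaches _ _ _ _ (_, X)) => r2.
  exists m2; split; first by rewrite size_cat addnA; exact: r2.
  + rewrite /m2 upd_same -(agree_cells a1); set t := eval _ _ _ _ _.
    set m4 := upd (upd (upd _ _ _) (scr d.+1) 9) (scr d) _.
    have -> : m4 (scr d) = cell t.
      by rewrite /m4 upd_same; upds; rewrite v1 -(agree_cells a1) -/t /cell; lia.
    by rewrite /m4 /cells; upds.
  + rewrite /m2; do 5 (apply: agree_upd; first by lia).
    by apply: agree_trans a1 (@agree_refl d 0 _) _ _ _ _; lia.
- move: hc => /=; set c := compe e _ _.
  move=> hc.
  have {hc} [hA hc] := @code_at_cat _ _
    [:: IConst (scr d) 0; mov (scr d.+1) rN; mov (scr d.+2) (var x)] _ hc.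
  have {hc} [hB hc] := code_at_cons hc.
  have {hc} [hC hc] := @code_at_cat _ _
    [:: ISub (scr d.+1) (scr d.+1) rOne; mov (var x) (scr d.+1)] _ hc.
  have {hc} [hD hc] := code_at_cat hc.
  have {hc} [hE hc] := @code_at_cat _ _ [:: _] _ hc.
  have {hc} [hF hG] := code_at_cons hc.
  rewrite /= in hB hC hD hE hF hG.
  pose n := m rN; pose ev k := eval w n (upd (vars m) x k) (cells m) e.
  (* The counter descends, so with [k] rounds left the terms already added are those of index [k] to
     [n - 1]. Register [var x] is exempt from the frame condition until the last move restores it
     from [scr d.+2]. *)
  pose Inv k (m1 : memory) := [/\ m1 (scr d.+1) = k, m1 (scr d) = \sum_(k <= j < n) ev j,
    m1 (scr d.+2) = m (var x), k <= n & forall r, r != var x ->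
      (forall j, d <= j < d + (width e + 3) -> r != scr j) -> m1 r = m r].
  have eB : (pc + 3).+1 = pc + 4 by lia.
  have eD : (pc + 3).+1 + 2 = pc + 6 by lia.
  rewrite eD in hD.
  have eT : pc + 6 + size c + 1 = pc + 7 + size c by lia.
  rewrite eD eT in hF hG.
  pose m0 := foldl (fun m i => effect w i m) m
    [:: IConst (scr d) 0; mov (scr d.+1) rN; mov (scr d.+2) (var x)].
  have m0O : m0 rOne = 1 by rewrite /m0 /= /effect /=; upds.
  have [|k m1|||m2 r2 i2] := @reaches_loop P w (pc + 4) (pc + 7 + size c) (scr d.+1)
     (cost e n + 3) Inv _ _ _ n
     m0.
  + by [].
  + by case.
  + move=> k m1 [i1 i2 i3 i4 i5].
    rewrite -eB; have r1 := reaches_straight w m1 hC isT.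
    move: r1; rewrite /= /effect /= eB addn2 => r1.
    set m2 := (X in reaches _ _ _ _ (_, X)) in r1.
    have m1O : m1 rOne = 1 by rewrite i5 // => *; regs.
    have m1Z : m1 rZero = 0 by rewrite i5 // => *; regs.
    have m1N : m1 rN = n by rewrite i5 // => *; regs.
    have m2d1 : m2 (scr d.+1) = k by rewrite /m2; upds; rewrite i1 m1O; lia.
    have m2x : vars m2 = upd (vars m) x k.
      apply: functional_extensionality => y; rewrite /vars /m2.
      have [->|ne] := eqVneq y x; first by rewrite !upd_same; upds; rewrite m1Z i1 m1O; lia.
      rewrite [RHS]upd_neq // upd_neq; last by move: ne; regs.
      upds; apply: i5; first by move: ne; regs.
      by move=> *; regs.
    have m2c : cells m2 = cells m.
      apply: functional_extensionality => y; rewrite /cells /m2; upds; apply: i5; first by regs.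
      by move=> *; regs.
    have e6 : (pc + 4).+2 = pc + 6 by lia.
    rewrite e6 in r1.
    have [||m3 [r3 v3 a3]] := IH (d + 3) (pc + 6) m2 hD; [by rewrite /m2; upds|by rewrite /m2; upds|].
    have m2N : m2 rN = n by rewrite /m2; upds.
    exists (upd m3 (scr d) (m3 (scr d) + m3 (scr (d + 3)))).
      have := reaches_straight w m3 hE isT.
      rewrite eD /= eT => /(reaches_trans r3) /(reaches_trans r1).
      by apply: reaches_le; rewrite m2N; lia.
    split.
    * by rewrite upd_neq ?(agree_scr a3) //; regs.
    * rewrite upd_same v3 (agree_scr a3) ?m2N ?m2x ?m2c; last by lia.
      by rewrite [RHS]big_ltn // /ev addnC; congr (_ + _); rewrite /m2; upds.
    * by rewrite upd_neq ?(agree_scr a3) /m2; upds => //; regs.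
    * by lia.
    * move=> r rx hr; rewrite upd_neq; last by apply: hr; lia.
      rewrite a3; last by move=> j hj; apply: hr; lia.
      rewrite /m2 upd_neq // upd_neq ?i5 //.
      by apply: hr; have := width_gt0 e; lia.
  + rewrite /m0 /= /effect /=; split; upds; rewrite ?h0 ?addn0 ?big_geq //.
    move=> r rx hr; do 3 (rewrite upd_neq; last by apply: hr; have := width_gt0 e; lia).
    by [].
  case: i2 => i1 i2 i3 _ i5.
  have m2Z : m2 rZero = 0 by rewrite i5 // => *; regs.
  exists (upd m2 (var x) (m2 (scr d.+2) + m2 rZero)); split.
  + have rA := reaches_straight w m hA isT.
    have := reaches_jump w m0 hB; rewrite m0O /= => rB.
    have rG := reaches_straight w m2 hG isT.
    have := reaches_trans (reaches_trans rA rB) (reaches_trans r2 rG).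
    have -> : (pc + 7 + size c).+1 + 1 =
        pc + (size (c ++ [:: IAdd (scr d) (scr d) (scr (d + 3));
          IJumpPos (scr d.+1) (pc + 4); mov (var x) (scr d.+2)])).+2.+4.
      by rewrite size_cat /=; lia.
    by apply: reaches_le => /=; rewrite -/n; lia.
  + by upds; rewrite i2.
  + move=> r hr /=; rewrite /=.
    have [->|ne] := eqVneq r (var x); first by rewrite upd_same i3 m2Z addn0.
    by rewrite upd_neq // i5.
Qed.

End CompileCorrect.

(** * Commands, running times and relocation *)

Inductive cmd :=
| CSet of nat & exp
| CStore of exp & exp
| CSeq of cmd & cmd
| CFor of nat & cmd.

Definition state := ((nat -> nat) * (nat -> nat))%type.

(** Descending, because the compiled loop decrements its counter and then uses it as the loop
    value. *)
Fixpoint downto (f : nat -> state -> state) (k : nat) (s : state) : state :=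
  if k is k'.+1 then downto f k' (f k' s) else s.

Fixpoint denote (w : seq nat) (n : nat) (c : cmd) (s : state) : state :=
  match c with
  | CSet x e => (upd s.1 x (eval w n s.1 s.2 e), s.2)
  | CStore e1 e2 => (s.1, upd s.2 (eval w n s.1 s.2 e1) (eval w n s.1 s.2 e2))
  | CSeq c1 c2 => denote w n c2 (denote w n c1 s)
  | CFor x c => downto (fun k s => denote w n c (upd s.1 x k, s.2)) n s
  end.

Fixpoint compc (c : cmd) (d pc : nat) : program :=
  match c with
  | CSet x e => compe e d pc ++ [:: mov (var x) (scr d)]
  | CStore e1 e2 =>
      let c1 := compe e1 d pc in
      c1 ++ compe e2 d.+1 (pc + size c1) ++
      [:: IAdd (scr d.+2) (scr d) (scr d); IAdd (scr d) (scr d) (scr d.+2);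
          IConst (scr d.+2) 9; IAdd (scr d) (scr d) (scr d.+2);
          IStore (scr d) (scr d.+1)]
  | CSeq c1 c2 => let p1 := compc c1 d pc in p1 ++ compc c2 d (pc + size p1)
  | CFor x c =>
      let p := compc c d.+1 (pc + 4) in
      [:: mov (scr d) rN] ++
      [:: IJumpPos rOne (pc + 4 + size p)] ++
      [:: ISub (scr d) (scr d) rOne; mov (var x) (scr d)] ++
      p ++ [:: IJumpPos (scr d) (pc + 2)]
  end.

Fixpoint costc (c : cmd) (n : nat) : nat :=
  match c with
  | CSet _ e => cost e n + 1
  | CStore e1 e2 => cost e1 n + cost e2 n + 5
  | CSeq c1 c2 => costc c1 n + costc c2 n
  | CFor _ c => n * (costc c n + 3) + 3
  end.

Definition state_of (m : memory) : state := (vars m, cells m).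

Definition keeps (d : nat) (m m' : memory) : Prop :=
  [/\ m' rN = m rN, m' rOne = m rOne, m' rZero = m rZero &
      forall j, j < d -> m' (scr j) = m (scr j)].

Lemma keeps_trans d m1 m2 m3 : keeps d m1 m2 -> keeps d m2 m3 -> keeps d m1 m3.
Proof.
move=> [a1 a2 a3 a4] [b1 b2 b3 b4].
by split; [rewrite b1|rewrite b2|rewrite b3|move=> j hj; rewrite b4 ?a4].
Qed.

Lemma agree_keeps d d' k m m' : agree d' k m m' -> d <= d' -> keeps d m m'.
Proof.
move=> h hd; have [? ? ?] := agree_base h; split=> // j hj.
by apply: (agree_scr h); apply: leq_trans hd.
Qed.

Lemma keepsW d d' m m' : d <= d' -> keeps d' m m' -> keeps d m m'.
Proof. by move=> hd [? ? ? h]; split=> // j hj; apply: h; lia. Qed.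

Lemma keeps_var d m x v : keeps d m (upd m (var x) v).
Proof. by split=> *; upds. Qed.

Section CompileCommands.
Variables (P : program) (w : seq nat).

Lemma compc_correct c : forall d pc m,
  code_at P pc (compc c d pc) -> m rOne = 1 -> m rZero = 0 ->
  exists m',
   [/\ reaches P w (costc c (m rN)) (pc, m) (pc + size (compc c d pc), m'),
       state_of m' = denote w (m rN) c (state_of m) & keeps d m m'].
Proof.
elim: c => [x e|e1 e2|c1 IH1 c2 IH2|x c IH] d pc m hc h1 h0.
- move: hc => /= /code_at_cat [hc1 hc2].
  have [m1 [r1 v1 a1]] := compe_correct w hc1 h1 h0.
  exists (upd m1 (var x) (m1 (scr d) + m1 rZero)); split.
  + have := reaches_straight w m1 hc2 isT.
    by move=> /(reaches_trans r1); rewrite size_cat !addnA.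
  + have [_ _ ->] := agree_base a1.
    rewrite /state_of vars_upd_var cells_upd_var (agree_vars a1) (agree_cells a1).
    by rewrite h0 addn0 v1.
  + apply: keeps_trans (keeps_var _ _ _ _).
    exact: agree_keeps a1 _.
- move: hc => /= /code_at_cat [hc1 /code_at_cat [hc2 hc3]].
  have [m1 [r1 v1 a1]] := compe_correct w hc1 h1 h0.
  have [eN eO eZ] := agree_base a1.
  have [|| m2 [r2 v2 a2]] := compe_correct (m := m1) w hc2; rewrite ?eO ?eZ //.
  have := reaches_straight w m2 hc3 isT.
  move=> /(reaches_trans r2) /(reaches_trans r1) /=.
  rewrite /effect /=; set m3 := (X in reaches _ _ _ _ (_, X)).
  move=> r3; exists m3.
  have k2 : keeps d m m2.
    by apply: (keeps_trans (agree_keeps a1 _) (agree_keeps a2 _)).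
  set t1 := eval w (m rN) (vars m) (cells m) e1.
  set t2 := eval w (m rN) (vars m) (cells m) e2.
  have v2d : m2 (scr d) = t1 by rewrite (agree_scr a2) // v1.
  have v2d1 : m2 (scr d.+1) = t2 by rewrite v2 eN (agree_vars a1) (agree_cells a1).
  have {}r3 : reaches P w (cost e1 (m rN) + cost e2 (m rN) + 5) (pc, m)
     (pc + size (compe e1 d pc ++ compe e2 d.+1 (pc + size (compe e1 d pc)) ++
      [:: IAdd (scr d.+2) (scr d) (scr d); IAdd (scr d) (scr d) (scr d.+2);
          IConst (scr d.+2) 9; IAdd (scr d) (scr d) (scr d.+2);
          IStore (scr d) (scr d.+1)]), m3).
    by rewrite !size_cat !addnA; move: r3; rewrite eN addnA.
  set m4 := upd (upd (upd _ _ _) (scr d.+2) 9) (scr d) _ in m3 r3 *.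
  have a4 : agree d 3 m2 m4 by rewrite /m4; do 4 (apply: agree_upd; first lia).
  have e4 : m4 (scr d) = cell t1.
    by rewrite /m4 upd_same; upds; rewrite v2d /cell; lia.
  have e4' : m4 (scr d.+1) = t2 by rewrite /m4; upds.
  split=> //.
  + rewrite /m3 e4 e4' /state_of vars_upd_cell cells_upd_cell.
    by rewrite (agree_vars a4) (agree_vars a2) (agree_vars a1)
      (agree_cells a4) (agree_cells a2) (agree_cells a1).
  + apply: keeps_trans k2 _; apply: keeps_trans (agree_keeps a4 (leqnn _)) _.
    by rewrite /m3 e4; split=> *; upds.
- move: hc => /= /code_at_cat [hc1 hc2].
  have [m1 [r1 v1 [k1 k2 k3 k4]]] := IH1 _ _ _ hc1 h1 h0.
  have [|| m2 [r2 v2 l2]] := IH2 _ _ m1 hc2; rewrite ?k2 ?k3 //.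
  exists m2; split.
  + by have := reaches_trans r1 r2; rewrite size_cat addnA k1.
  + by rewrite v2 v1 k1.
  + by apply: keeps_trans l2.
- move: hc => /=; set p := compc c _ _ => hc.
  have {hc} [hA hc] := @code_at_cat _ _ [:: mov (scr d) rN] _ hc.
  have {hc} [hB hc] := code_at_cons hc.
  have {hc} [hC hc] := @code_at_cat _ _
    [:: ISub (scr d) (scr d) rOne; mov (var x) (scr d)] _ hc.
  have {hc} [hD /code_at_cons [hF _]] := code_at_cat hc.
  rewrite /= in hB hC hD hF.
  have eB : (pc + 1).+1 = pc + 2 by lia.
  have eD : (pc + 1).+1 + 2 = pc + 4 by lia.
  rewrite eD in hD hF.
  pose n := m rN.
  pose F := fun k s => denote w n c (upd s.1 x k, s.2).
  (* The invariant compares futures: the [k] remaining rounds lead from here to where all [n] rounds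
     lead from the start. The counter sits in [scr d], out of reach of a body compiled at [d.+1], so
     the body may even overwrite [x]. *)
  pose Inv k (m1 : memory) := [/\ m1 (scr d) = k,
    downto F k (state_of m1) = downto F n (state_of m) & keeps d m m1].
  pose m0 := foldl (fun m i => effect w i m) m [:: mov (scr d) rN].
  have m0O : m0 rOne = 1 by rewrite /m0 /= /effect /=; upds.
  have a0 : agree d 1 m m0 by rewrite /m0 /= /effect /=; apply: agree_upd; first lia.
  have [|k m1|||m2 r2 [_ i2 i3]] := @reaches_loop P w (pc + 2) (pc + 4 + size p) (scr d)
     (costc c n + 2) Inv _ _ _ n m0.
  + by [].
  + by case.
  + move=> k m1 [i1 i2 [kN kO kZ kS]].
    have := reaches_straight w m1 hC isT.
    rewrite /= /effect /= eB => r1.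
    set m2 := (X in reaches _ _ _ _ (_, X)) in r1.
    have m2d : m2 (scr d) = k by rewrite /m2; upds; rewrite i1 kO h1; lia.
    have km2 : keeps d m m2.
      by split; rewrite /m2 => *; upds => //; apply: kS.
    have [kN2 kO2 kZ2 kS2] := km2.
    have sm2 : state_of m2 = (upd (vars m1) x k, cells m1).
      rewrite /state_of /m2 vars_upd_var cells_upd_var.
      have a1 : agree d 1 m1 (upd m1 (scr d) (m1 (scr d) - m1 rOne)) by apply: agree_upd; first lia.
      rewrite (agree_vars a1) (agree_cells a1); congr (upd _ _ _, _).
      by upds; rewrite i1 kO h1 kZ h0; lia.
    have e6 : pc + 2 + 2 = pc + 4 by lia.
    rewrite e6 in r1.
    have [||m3 [r3 v3 k3]] := IH d.+1 (pc + 4) m2 hD; rewrite ?kO2 ?kZ2 //.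
    exists m3.
      have := reaches_trans r1 r3.
      by apply: reaches_le; rewrite kN2 -/n /=; lia.
    split.
    * by case: k3 => _ _ _ ->.
    * by rewrite -i2 v3 sm2 kN2.
    * apply: keeps_trans km2 _; exact: keepsW k3.
  + split.
    * by rewrite /m0 /= /effect /=; upds; rewrite h0 addn0.
    * by rewrite /state_of (agree_vars a0) (agree_cells a0).
    * exact: agree_keeps a0 _.
  exists m2; split=> //.
  have rA := reaches_straight w m hA isT.
  have := reaches_jump w m0 hB; rewrite m0O /= => rB.
  have := reaches_trans (reaches_trans rA rB) r2.
  have -> : (pc + 4 + size p).+1 =
      pc + (size (p ++ [:: IJumpPos (scr d) (pc + 2)])).+4 by rewrite size_cat /=; lia.
  by apply: reaches_le => /=; rewrite -/n; lia.
Qed.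

End CompileCommands.

(** The base [n.+1] is positive, so a larger exponent only weakens the bound, even at [n = 0];
    bounds can then be added without comparing exponents. *)
Definition poly_bounded (f : nat -> nat) : Prop :=
  exists c k, forall n, f n <= c * n.+1 ^ k.

Lemma poly_boundedD f g :
  poly_bounded f -> poly_bounded g -> poly_bounded (fun n => f n + g n).
Proof.
move=> [c1 [k1 h1]] [c2 [k2 h2]]; exists (c1 + c2), (k1 + k2) => n.
rewrite mulnDl; apply: leq_add.
  apply: leq_trans (h1 n) _; rewrite leq_mul2l leq_pexp2l ?leq_addr ?orbT //.
apply: leq_trans (h2 n) _; rewrite leq_mul2l leq_pexp2l ?leq_addl ?orbT //.
Qed.

Lemma poly_bounded_const c : poly_bounded (fun=> c).
Proof. by exists c, 0 => n; rewrite expn0 muln1. Qed.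

Lemma poly_bounded_mul f : poly_bounded f -> poly_bounded (fun n => n * f n).
Proof.
move=> [c [k h]]; exists c, k.+1 => n.
by rewrite expnS mulnCA; apply: leq_mul.
Qed.

Lemma poly_bounded_cost e : poly_bounded (cost e).
Proof.
elim: e => /= *; do ?[exact: poly_bounded_const | apply: poly_boundedD
  | apply: poly_bounded_mul | done].
Qed.

Lemma poly_bounded_costc c : poly_bounded (costc c).
Proof.
elim: c => /= *; do ?[exact: poly_bounded_const | exact: poly_bounded_cost
  | apply: poly_boundedD | apply: poly_bounded_mul | done].
Qed.

Definition relocate_instr (o : nat) (i : instr) : instr :=
  if i is IJumpPos r l then IJumpPos r (o + l) else i.

Definition relocate (o : nat) (P : program) : program := map (relocate_instr o) P.

(** This covers addresses past the end of [P], where both sides are [IHalt]: as the relocated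
    program comes last, leaving it still means halting. *)
Lemma fetch_relocate (Q P : program) pc m :
  fetch (Q ++ relocate (size Q) P) (size Q + pc, m) =
  relocate_instr (size Q) (fetch P (pc, m)).
Proof.
rewrite /fetch /= nth_cat ltnNge leq_addr /= addKn.
have [lt|ge] := ltnP pc (size P); first by rewrite (nth_map IHalt).
by rewrite !nth_default ?size_map.
Qed.

Lemma step_relocate (Q P : program) w pc m :
  step (Q ++ relocate (size Q) P) w (size Q + pc, m) =
  let s := step P w (pc, m) in (size Q + s.1, s.2).
Proof.
rewrite /step fetch_relocate; case: (fetch _ _) => //=; rewrite ?addnS //.
by move=> i l; case: ifP; rewrite ?addnS.
Qed.

Lemma iter_relocate (Q P : program) w t m :
  iter t (step (Q ++ relocate (size Q) P) w) (size Q, m) =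
  let s := iter t (step P w) (0, m) in (size Q + s.1, s.2).
Proof.
elim: t => [|t IH]; first by rewrite /= addn0.
by rewrite !iterS IH; case: (iter _ _ _) => pc m'; apply: step_relocate.
Qed.

(** * Cut colourings and 2-SAT *)

Definition embedding (W V : finType) (H : sgraph W) (G : sgraph V) (d : W -> V) : Prop :=
  injective d /\ forall x y, G (d x) (d y) = H x y.

(** Turns copies of [H] into maps on the fixed set [W], that is, tuples of vertices, which nested
    loops can run through. *)
Lemma induced_freePn (W V : finType) (H : sgraph W) (G : sgraph V) :
  induced_free H G <-> ~ exists d, embedding H G d.
Proof.
split=> hf; last first.
  move=> [S [f [[g fK gK] hfH]]]; apply: hf.
  exists (fun x => val (g x)); split; first by apply: inj_comp val_inj (can_inj gK).
  by move=> x y; have := hfH (g x) (g y); rewrite !gK.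
move=> [d [dinj dG]]; apply: hf; exists (d @: [set: W]).
have inS x : d x \in d @: [set: W] by apply: imset_f; rewrite inE.
pose g x : {x : V | x \in d @: [set: W]} := Sub (d x) (inS x).
have gsurj (u : {x : V | x \in d @: [set: W]}) : exists x, g x == u.
  by have /imsetP [x _ ux] := valP u; exists x; apply/eqP/val_inj; rewrite /= ux.
pose f u := xchoose (gsurj u).
have fK : cancel f g by move=> u; apply/eqP/(xchooseP (gsurj u)).
have gK : cancel g f by move=> x; apply: dinj; have := congr1 val (fK (g x)).
exists f; split; first by exists g.
by move=> u v; rewrite -dG -{2}(fK u) -{2}(fK v).
Qed.

Definition cut_colouring (V : finType) (G : sgraph V) (f : V -> bool) : Prop :=
  (exists x y, f x != f y) /\
  forall x y z, G x y -> G x z -> f y != f x -> f z != f x -> y = z.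

Lemma setU2_inj (V : finType) (x y z : V) : [set x; y] = [set x; z] -> y = z.
Proof.
move=> h; have : y \in [set x; z] by rewrite -h !inE eqxx orbT.
have : z \in [set x; y] by rewrite h !inE eqxx orbT.
by rewrite !inE => /orP [] /eqP e1 /orP [] /eqP e2; subst.
Qed.

(** Given [M], colour by reachability from one vertex in [G - M]: a bichromatic edge must lie in
    [M], and two of them at the same vertex would intersect. Conversely, the bichromatic edges of a
    colouring form the matching, and a path that avoids them keeps its colour. *)
Lemma has_matching_cutP (V : finType) (G : sgraph V) :
  has_matching_cut G <-> exists f, cut_colouring G f.
Proof.
split.
  move=> /existsP [M /andP [/andP [/subsetP Msub Mtriv] /forallPn /= [x /forallPn /= [y nxy]]]].
  exists (fun v => connect (delete_edges G M) x v); split.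
    by exists x, y; rewrite connect0 (negbTE nxy).
  have csym : connect_sym (delete_edges G M).
    by apply: sym_connect_sym; apply: adj_sym.
  have inM u v : G u v -> connect (delete_edges G M) x v != connect (delete_edges G M) x u ->
      [set u; v] \in M.
    move=> Guv; apply: contraNT => nM; apply/eqP.
    by apply/esym/(same_connect_r csym)/connect1; rewrite /= /delete_adj Guv nM.
  move=> u v1 v2 G1 G2 h1 h2; have M1 := inM _ _ G1 h1; have M2 := inM _ _ G2 h2.
  apply: (@setU2_inj _ u); apply/eqP; apply: contraT => ne.
  have /trivIsetP /(_ _ _ M1 M2 ne) := Mtriv.
  by move/disjoint_setI0/setP/(_ u); rewrite !inE eqxx.
move=> [f [[x0 [y0 ne0]] hf]].
pose M := [set e | [exists x, exists y, [&& G x y, f x != f y & e == [set x; y]]]].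
have MP (e : {set V}) v : e \in M -> v \in e -> exists2 u, e = [set v; u] & G v u && (f u != f v).
  rewrite inE => /existsP [x /existsP [y /and3P [Gxy nf /eqP ->]]].
  rewrite !inE => /orP [] /eqP ->.
    by exists y; rewrite // Gxy eq_sym nf.
  by exists x; rewrite 1?setUC // adj_sym Gxy nf.
apply/existsP; exists M; apply/andP; split.
  apply/andP; split.
    apply/subsetP => e; rewrite !inE => /existsP [x /existsP [y /and3P [Gxy _ he]]].
    by apply/existsP; exists x; apply/existsP; exists y; rewrite Gxy.
  apply/trivIsetP => A B MA MB; apply: contraNT => /pred0Pn [v /andP [/= vA vB]].
  have [u -> /andP [G1 f1]] := MP _ _ MA vA.
  have [u' -> /andP [G2 f2]] := MP _ _ MB vB.
  by rewrite (hf _ _ _ G1 G2 f1 f2).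
apply/forallPn; exists x0; apply/forallPn; exists y0.
apply/negP => /connectP [p hp ey]; case/negP: ne0; rewrite {}ey.
elim: p x0 hp => //= z p IH x /andP [/andP [Gxz nM] hp].
rewrite -(eqP (IH _ hp)); apply: contraR nM => nf.
by rewrite inE; apply/existsP; exists x; apply/existsP; exists z; rewrite Gxz nf /=.
Qed.

(** * 2-SAT through reachability in the implication graph *)

Section TwoSat.
Variables (V : finType) (imp : rel (V * bool)).

Definition neg (l : V * bool) := (l.1, ~~ l.2).
Hypothesis imp_neg : forall l l', imp l l' = imp (neg l') (neg l).

Definition satisfies (f : V -> bool) : Prop :=
  forall l l', imp l l' -> f l.1 = l.2 -> f l'.1 = l'.2.

Lemma negK : involutive neg.
Proof. by case=> v b; rewrite /neg /= negbK. Qed.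

Lemma connect_neg l l' : connect imp l l' -> connect imp (neg l') (neg l).
Proof.
move=> /connectP [p]; elim: p l => [|l1 p IH] l /=; first by move=> _ ->.
move=> /andP [h hp] e; apply: connect_trans (IH _ hp e) _.
by apply: connect1; rewrite -imp_neg.
Qed.

Lemma satisfies_connect f l l' :
  satisfies f -> connect imp l l' -> f l.1 = l.2 -> f l'.1 = l'.2.
Proof.
move=> hf /connectP [p]; elim: p l => [|l1 p IH] l /=; first by move=> _ ->.
by move=> /andP [h hp] e hl; apply: IH hp e (hf _ _ h hl).
Qed.

Definition closed_consistent (S : {set V * bool}) :=
  [forall l in S, [forall l', imp l l' ==> (l' \in S)] && (neg l \notin S)].

(** Contraposition does it: if [l] reached the negation of a member of [S], or a literal whose
    negation is in [S], then [neg l] would be in [S]; if [l] reached both [a] and [neg a], it would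
    reach [neg l] through [neg a]. *)
Lemma twosat_extend S l : closed_consistent S -> l \notin S -> neg l \notin S ->
  ~~ connect imp l (neg l) -> closed_consistent (S :|: [set l' | connect imp l l']).
Proof.
move=> /forall_inP hS lS nlS nll.
have Sc a b : a \in S -> connect imp a b -> b \in S.
  move=> aS /connectP [p hp ->]; elim: p a aS hp => //= c p IH a aS /andP [h].
  by apply: IH; have /andP [/forallP /(_ c) /implyP -> //] := hS _ aS.
apply/forall_inP => a; rewrite !inE => ha; apply/andP; split.
  apply/forallP => b; apply/implyP => ab; rewrite !inE.
  case/orP: ha => ha; first by rewrite (Sc _ _ ha (connect1 ab)).
  by rewrite (connect_trans ha (connect1 ab)) orbT.
rewrite negb_or; case/orP: ha => ha; apply/andP; split.
- by have /andP [] := hS _ ha.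
- apply: contra nlS => /connect_neg; rewrite negK; exact: Sc ha.
- apply: contra nlS => naS; apply: Sc naS _; exact: connect_neg.
- apply: contra nll => h; apply: connect_trans h _.
  exact: connect_neg.
Qed.

(** From right to left, a closed consistent set of literals of maximal size decides every variable:
    if [x] were undecided, one of its two literals would not reach its negation, and that literal
    could be added with all it implies. *)
Lemma twosatP : (exists f, satisfies f) <->
  forall x, ~~ (connect imp (x, false) (x, true) && connect imp (x, true) (x, false)).
Proof.
split=> [[f hf] x|hx].
  apply/negP => /andP [h1 h2]; case fx: (f x).
    by have := satisfies_connect hf h2 fx; rewrite /= fx.
  by have := satisfies_connect hf h1 fx; rewrite /= fx.
have h0 : closed_consistent set0 by apply/forall_inP => l; rewrite inE.
have [S hS Smax] := @arg_maxnP _ set0 closed_consistent (fun S => #|S|) h0.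
have total x : ((x, true) \in S) || ((x, false) \in S).
  apply/negPn/negP; rewrite negb_or => /andP [nt nf].
  have [l [lS nlS nll]] : exists l, [/\ l \notin S, neg l \notin S & ~~ connect imp l (neg l)].
    case hc : (connect imp (x, true) (x, false)).
      by exists (x, false); split=> //; have := hx x; rewrite hc andbT.
    by exists (x, true); rewrite /neg /= hc.
  have /Smax := twosat_extend hS lS nlS nll; rewrite /geq /= leqNgt => /negP; apply.
  apply: proper_card; rewrite properE subsetUl /=.
  by apply/subsetPn; exists l; rewrite // !inE connect0 orbT.
exists (fun x => (x, true) \in S) => -[a al] [b be] /= ab fa.
have /forall_inP hS' := hS.
have aS : (a, al) \in S.
  by case: al fa {ab} => // fa; have := total a; rewrite fa.
have /andP [/forallP /(_ (b, be))] := hS' _ aS; rewrite ab /= => bS _.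
case: be bS {ab} => // bS; have /andP [_] := hS' _ bS; by rewrite /neg /= => /negbTE.
Qed.
End TwoSat.

(** * The 2-clauses that a guess produces *)

Section Clauses.
Variables (W V : finType) (H : sgraph W) (G : sgraph V).
Variables (d e : W -> V) (c : W -> bool) (r s : V).

(** A neighbour of [d i] shares the colour of [d i] unless it is the guessed exception [e i], hence
    the [(+)]. A wrong guess may force both colours on one vertex; its clauses are then
    contradictory. *)
Definition forced (v : V) (g : bool) : bool :=
  [exists i, ((v == d i) && (g == c i)) || (G (d i) v && (g == c i (+) (v == e i)))].

(** The implication from [(a, ~~ g)] to [(b, g)]. For [a = b] it is a unit clause, which also
    records that [r] is false and [s] true; for [a != b] it says that a common neighbour of colour
    [g] cannot see the other colour twice. *)
Definition clause_neq (g : bool) (a b : V) : bool :=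
  ((a == b) && (forced b g || (b == if g then s else r))) ||
  ((a != b) && [exists t, [&& G t a, G t b & forced t g]]).

(** The implication from [(a, g)] to [(b, g)] along an edge. If it failed, then respectively [b]
    would have [t] and [a] on the other side, [a] would have [t] and [b] there, or some vertex of
    the triangle would be opposed to the two others. *)
Definition clause_eq (g : bool) (a b : V) : bool :=
  G a b && [exists t, [|| [&& G t b, t != a & forced t g],
     [&& G t a, t != b & forced t (~~ g)] | G t a && G t b]].

Definition implication : rel (V * bool) := fun l l' =>
  if l.2 == l'.2 then clause_eq l'.2 l.1 l'.1 else clause_neq l'.2 l.1 l'.1.

(** Contraposition exchanges the first two alternatives of [clause_eq] and fixes the third, while
    [clause_neq] is symmetric in its two vertices. *)
Lemma implication_neg l l' : implication l l' = implication (neg l') (neg l).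
Proof.
case: l l' => a al [b be]; rewrite /implication /neg /=.
have -> : (~~ be == ~~ al) = (al == be) by case: al; case: be.
case: eqP => [<-|ne].
  rewrite /clause_eq adj_sym negbK; congr (_ && _); apply: eq_existsb => t.
  by rewrite orbCA; congr [|| _, _ | _]; rewrite andbC.
have -> : ~~ al = be by case: al be ne => -[].
rewrite /clause_neq eq_sym; congr (_ || _).
  by case: eqP => // ->.
by congr (_ && _); apply: eq_existsb => t; rewrite andbCA.
Qed.

Definition solvable2 : bool := [forall x,
  ~~ (connect implication (x, false) (x, true) && connect implication (x, true) (x, false))].

Lemma solvable2P : solvable2 <-> exists f, satisfies implication f.
Proof.
split; first by move=> /forallP h; apply/twosatP => //; apply: implication_neg.
by move=> h; apply/forallP; apply/twosatP => //; apply: implication_neg.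
Qed.

(* Outside the closed neighbourhood of the copy of [H] the graph is [P_3]-free,
   so two neighbours of an unforced vertex there are adjacent, and the three
   vertices form a triangle, which is monochromatic. *)
Lemma solvable_cut : embedding H G d -> induced_free (dunion H (path_graph 3)) G ->
  solvable2 -> exists f, cut_colouring G f.
Proof.
move=> [dinj dG] /induced_freePn hfree /solvable2P [f hf].
have fforced v g : forced v g -> f v = g.
  move=> hv; case: (f v =P g) => // /eqP ne.
  apply: (hf (v, ~~ g) (v, g)) => /=; last by case: (f v) g ne {hv} => -[].
  by rewrite /implication /= /clause_neq eqxx hv; case: g ne hv.
exists f; split.
  exists r, s.
  have -> : f r = false.
    case fr: (f r) => //; rewrite -fr; apply: (hf (r, true) (r, false)) => //.
    by rewrite /implication /= /clause_neq !eqxx orbT.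
  have -> // : f s = true.
  case fs: (f s) => //; rewrite -fs; apply: (hf (s, false) (s, true)) => //.
  by rewrite /implication /= /clause_neq !eqxx orbT.
move=> x y z Gxy Gxz fy fz; apply/eqP/negPn/negP => yz.
(* Now [y] and [z] are distinct neighbours of [x], both of the other colour. A forced colour at any
   of the three vertices would give a clause that excludes this. *)
have nfx g : ~~ forced x g.
  apply/negP => Fx; have fx := fforced _ _ Fx.
  have : f z = g.
    apply: (hf (y, ~~ g) (z, g)) => /=; last by move: fy; rewrite fx; case: (f y) g {fx Fx} => -[].
    rewrite /implication /= /clause_neq yz; case: g Fx {fx} => Fx /=; apply/orP; right;
    by apply/existsP; exists x; rewrite Gxy Gxz.
  by move=> efz; move: fz; rewrite efz fx eqxx.
have key u v g : G x u -> G x v -> u != v -> f u != f x -> f v != f x -> ~~ forced u g.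
  move=> Gxu Gxv uv fu fv; apply/negP => Fu; have eu := fforced _ _ Fu.
  have : f x = g.
    apply: (hf (v, g) (x, g)) => /=; last by move: fu fv; rewrite -eu; case: (f u) (f v) (f x) => -[] [].
    rewrite /implication /= eqxx /clause_eq adj_sym Gxv /=; apply/existsP; exists u.
    by rewrite adj_sym Gxu uv Fu.
  by move=> ex; move: fu; rewrite eu ex eqxx.
have nfy g : ~~ forced y g by apply: (key y z).
have nfz g : ~~ forced z g by apply: (key z y) => //; rewrite eq_sym.
have unf v : (forall g, ~~ forced v g) -> forall i, v != d i /\ G (d i) v = false.
  move=> hv i; split.
    by have := hv (c i); rewrite negb_exists => /forallP /(_ i); rewrite eqxx andbT; case: eqP.
  by have := hv (c i (+) (v == e i)); rewrite negb_exists => /forallP /(_ i); rewrite eqxx andbT orbC; case: (G _ _).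
case Gyz: (G y z).
  have : f x = f y.
    apply: (hf (y, f y) (x, f y)) => //=.
    rewrite /implication /= eqxx /clause_eq adj_sym Gxy; apply/existsP; exists z.
    by rewrite [G z y]adj_sym Gyz [G z x]adj_sym Gxz !orbT.
  by move=> efx; rewrite efx eqxx in fy.
(* The path is [y], [x], [z]: its middle vertex [x] must receive index 1. *)
apply: hfree; pose q (i : 'I_3) := if val i is 0 then y else if val i is 1 then x else z.
exists (fun u => match u with inl i => d i | inr j => q j end).
have qun j : forall i, q j != d i /\ G (d i) (q j) = false.
  by case: j => [[|[|k]] hk]; [apply: (unf y) | apply: (unf x) | apply: (unf z)].
have xy : x != y by apply: contraTneq Gxy => ->; rewrite adj_irr.
have xz : x != z by apply: contraTneq Gxz => ->; rewrite adj_irr.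
split.
  move=> [i|j] [i'|j'] //.
  - by move=> /dinj ->.
  - by move=> /eqP; rewrite eq_sym; have [/negbTE ->] := qun j' i.
  - by move=> /eqP; have [/negbTE ->] := qun j i'.
  - move=> h; congr inr; apply: val_inj; move: h; rewrite /q.
    by case: j j' => [[|[|[|j]]] hj] [[|[|[|j']]] hj'] //= /eqP;
      rewrite ?(negbTE yz) ?(negbTE xy) ?(negbTE xz) // eq_sym
              ?(negbTE yz) ?(negbTE xy) ?(negbTE xz).
move=> [i|j] [i'|j'] //=.
- by have [_ ->] := qun j' i.
- by rewrite adj_sym; have [_ ->] := qun j i'.
- rewrite /q; case: j j' => [[|[|[|j]]] hj] [[|[|[|j']]] hj'] //=;
  by rewrite ?adj_irr ?Gyz ?Gxy ?Gxz // adj_sym ?Gyz ?Gxy ?Gxz.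
Qed.
End Clauses.

(** The copy is arbitrary, so completeness of the search may fix any embedding and read the rest of
    the guess off the colouring. *)
Lemma cut_solvable (W V : finType) (G : sgraph V) (d : W -> V) (f : V -> bool) :
  cut_colouring G f -> exists e c r s, solvable2 G d e c r s.
Proof.
move=> [[x [y nxy]] hf].
have [r [s [fr fs]]] : exists r s, f r = false /\ f s = true.
  by case fx: (f x) nxy; case fy: (f y) => // _; [exists y, x | exists x, y].
(* When [d i] has no neighbour of the other colour, [d i] itself stands in: it is not its own
   neighbour, so no neighbour gets flipped. *)
pose e i := odflt (d i) [pick v | G (d i) v && (f v != f (d i))].
exists e, (f \o d), r, s; apply/solvable2P; exists f.
have fforced v g : forced G d e (f \o d) v g -> f v = g.
  move=> /existsP [i /orP [/andP [/eqP -> /eqP -> //]|/andP [Gv /eqP ->]]] /=.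
  rewrite /e; case: pickP => [u /andP [Gu fu]|hno] /=.
    case: (v =P u) => [->|nvu]; first by case: (f u) (f (d i)) fu => -[].
    rewrite addbF; apply/eqP/negPn/negP => fv; apply: nvu; exact: hf Gv Gu fv fu.
  have -> : (v == d i) = false by apply: contraTF Gv => /eqP ->; rewrite adj_irr.
  by rewrite addbF; apply/eqP/negPn/negP => fv; have := hno v; rewrite Gv fv.
move=> [a al] [b be]; rewrite /implication /=; case: eqP => [->|ne].
  move=> /andP [Gab /existsP [t]] /or3P [/and3P [Gtb ta Ft]|/and3P [Gta tb Ft]|/andP [Gta Gtb]] fa.
  - apply/eqP/negPn/negP => fb; case/negP: ta; apply/eqP; apply: (hf b t a).
    + by rewrite adj_sym.
    + by rewrite adj_sym.
    + by rewrite (fforced _ _ Ft) eq_sym.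
    + by rewrite fa eq_sym.
  - apply/eqP/negPn/negP => fb; case/negP: tb; apply/eqP; apply: (hf a t b) => //.
    + by rewrite adj_sym.
    + by rewrite (fforced _ _ Ft) fa; case: be {fa fb Ft}.
    + by rewrite fa.
  - apply/eqP/negPn/negP => fb.
    (* Of the ends [a] and [b], now of different colours, [t] agrees with one; the other end then
       has two neighbours of the other colour. *)
    case ft: (f t == f a).
      have e1 : t = a.
        apply: (hf b t a); rewrite ?[G b _]adj_sym //.
          by rewrite (eqP ft) fa eq_sym.
        by rewrite fa eq_sym.
      by rewrite e1 adj_irr in Gta.
    have e1 : t = b.
      apply: (hf a t b); rewrite ?[G a _]adj_sym ?ft //; first by rewrite adj_sym.
      by rewrite fa.
    by rewrite e1 adj_irr in Gtb.
have -> : al = ~~ be by case: al be ne => -[].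
move=> /orP [/andP [/eqP -> /orP [/fforced //|]]|/andP [ab /existsP [t /and3P [Gta Gtb Ft]]]] fa.
  by case: be fa {ne} => /eqP ->; rewrite ?fr ?fs.
have ft := fforced _ _ Ft.
apply/eqP/negPn/negP => fb; case/negP: ab; apply/eqP; apply: (hf t a b) => //.
  by rewrite ft fa; case: be {fa fb Ft ft ne}.
by rewrite ft.
Qed.

(** * Formulas for the clauses *)

Lemma nth_allpairs (S T R : Type) (x0 : S) (y0 : T) (z0 : R) (f : S -> T -> R)
    (s : seq S) (t : seq T) i j : i < size s -> j < size t ->
  nth z0 [seq f x y | x <- s, y <- t] (i * size t + j) = f (nth x0 s i) (nth y0 t j).
Proof.
elim: s i => // x s IH [|i] hi hj; rewrite allpairs_cons nth_cat size_map.
  by rewrite mul0n add0n hj (nth_map y0).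
by rewrite mulSn -addnA ltnNge leq_addr /= addKn IH.
Qed.

Lemma nth_encode n (G : sgraph 'I_n) (i j : 'I_n) :
  nth 0 (encode G) (1 + i * n + j) = G i j.
Proof.
have hi : i < size (enum 'I_n) by rewrite size_enum_ord.
have hj : j < size (enum 'I_n) by rewrite size_enum_ord.
have := nth_allpairs i j 0 (fun x y => nat_of_bool (G x y)) hi hj.
by rewrite size_enum_ord !nth_ord_enum.
Qed.

Lemma size_encode n (G : sgraph 'I_n) : size (encode G) = (n * n).+1.
Proof. by rewrite /= size_allpairs size_enum_ord. Qed.

(** Truth is positivity. Truncated subtraction then gives negation, [EAdd] disjunction, and [ESum]
    existential quantification over the vertices of [G]. *)
Definition ENot e := ESub (EConst 1) e.
Definition EAnd e1 e2 := ENot (EAdd (ENot e1) (ENot e2)).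
Definition EEq e1 e2 := ENot (EAdd (ESub e1 e2) (ESub e2 e1)).
Definition EIff e1 e2 := EAdd (EAnd e1 e2) (EAnd (ENot e1) (ENot e2)).
Definition EBool (b : bool) := EConst b.
(** For quantifiers over the vertices of [H]: as [H] is fixed, they are unrolled into the formula
    and need no loop. *)
Definition EOrs (es : seq exp) := foldr EAdd (EConst 0) es.
Definition EAnds (es : seq exp) := ENot (EOrs (map ENot es)).

(* [x * n], for lack of a multiplication: the number of pairs [(k, j)] with
   [k < x] and [j < n].  Variables 0 and 1 are reserved for this. *)
Definition EMulN x := ESum 0 (ESum 1 (ENot (ENot (ESub (EVar x) (EVar 0))))).

(** The constant 1 skips the number of vertices, which heads the encoding. *)
Definition EAdj x y := ERead (EAdd (EAdd (EConst 1) (EMulN x)) (EVar y)).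

(* The variables holding the guess: two vertices of different colours and, for
   each vertex [i] of [H], its image, the exceptional neighbour of the image,
   and the colour of the image. *)
Definition xr := 12.
Definition xs := 13.
Definition xd (W : finType) (i : W) := 3 * enum_rank i + 14.
Definition xe (W : finType) (i : W) := 3 * enum_rank i + 15.
Definition xc (W : finType) (i : W) := 3 * enum_rank i + 16.

Definition guess_vars (W : finType) : seq nat :=
  xr :: xs :: [seq xd i | i <- enum W] ++ [seq xe i | i <- enum W] ++
  [seq xc i | i <- enum W].

Definition EForced (W : finType) v g :=
  EOrs [seq EAdd (EAnd (EEq (EVar v) (EVar (xd i))) (EIff (EBool g) (EVar (xc i))))
               (EAnd (EAdj (xd i) v)
                  (EIff (EBool g) (ENot (EIff (EVar (xc i)) (EEq (EVar v) (EVar (xe i)))))))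
       | i : W <- enum W].

Definition EClauseNeq (W : finType) (g : bool) a b :=
  EAdd (EAnd (EEq (EVar a) (EVar b))
             (EAdd (EForced W b g) (EEq (EVar b) (EVar (if g then xs else xr)))))
       (EAnd (ENot (EEq (EVar a) (EVar b)))
             (ESum 2 (EAnd (EAdj 2 a) (EAnd (EAdj 2 b) (EForced W 2 g))))).

Definition EClauseEq (W : finType) (g : bool) a b :=
  EAnd (EAdj a b) (ESum 2
    (EAdd (EAnd (EAdj 2 b) (EAnd (ENot (EEq (EVar 2) (EVar a))) (EForced W 2 g)))
    (EAdd (EAnd (EAdj 2 a) (EAnd (ENot (EEq (EVar 2) (EVar b))) (EForced W 2 (~~ g))))
          (EAnd (EAdj 2 a) (EAdj 2 b))))).

Definition EImp W (al be : bool) a b :=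
  if al == be then EClauseEq W be a b else EClauseNeq W be a b.

Definition EEmbed (W : finType) (H : sgraph W) :=
  EAnds [seq EAnd (if i == j then EConst 1 else ENot (EEq (EVar (xd i)) (EVar (xd j))))
                  (EIff (EBool (H i j)) (EAdj (xd i) (xd j))) | i <- enum W, j <- enum W].

Section Formulas.
Variables (n : nat) (G : sgraph 'I_n).
Implicit Types (v a : nat -> nat) (e : exp).

Definition truth v a e : bool := 0 < eval (encode G) n v a e.

Lemma truthN v a e : truth v a (ENot e) = ~~ truth v a e.
Proof. by rewrite /truth /= subn_gt0 ltnS leqn0 lt0n negbK. Qed.

Lemma truthD v a e1 e2 : truth v a (EAdd e1 e2) = truth v a e1 || truth v a e2.
Proof. by rewrite /truth /= addn_gt0. Qed.

Lemma truth_and v a e1 e2 : truth v a (EAnd e1 e2) = truth v a e1 && truth v a e2.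
Proof. by rewrite truthN truthD !truthN negb_or !negbK. Qed.

Lemma truth_eq v a e1 e2 :
  truth v a (EEq e1 e2) = (eval (encode G) n v a e1 == eval (encode G) n v a e2).
Proof. by rewrite truthN truthD /truth /= !subn_gt0 negb_or -!leqNgt eqn_leq andbC. Qed.

Lemma truth_neq v a e1 e2 :
  truth v a (ENot (EEq e1 e2)) = (eval (encode G) n v a e1 != eval (encode G) n v a e2).
Proof. by rewrite truthN truth_eq. Qed.

Lemma truth_iff v a e1 e2 : truth v a (EIff e1 e2) = (truth v a e1 == truth v a e2).
Proof. by rewrite truthD !truth_and !truthN; case: truth; case: truth. Qed.

Lemma truth_bool v a b : truth v a (EBool b) = b.
Proof. by rewrite /truth /= lt0b. Qed.

Lemma truth_sum v a x e :
  truth v a (ESum x e) = [exists k : 'I_n, truth (upd v x k) a e].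
Proof.
rewrite /truth /= big_mkord lt0n sum_nat_eq0 negb_forall.
by apply: eq_existsb => k; rewrite lt0n.
Qed.

Lemma truth_ors v a es : truth v a (EOrs es) = has (truth v a) es.
Proof. by elim: es => [|e es IH] //; rewrite [EOrs _]/= truthD IH. Qed.

Lemma truth_ands v a es : truth v a (EAnds es) = all (truth v a) es.
Proof.
rewrite truthN truth_ors has_map -all_predC; apply: eq_all => e /=.
by rewrite truthN negbK.
Qed.

Lemma eval_mulN v a x : 1 < x -> v x <= n ->
  eval (encode G) n v a (EMulN x) = v x * n.
Proof.
move=> hx hv /=.
transitivity (\sum_(0 <= k < n) n * (k < v x)).
  apply: eq_bigr => k _; transitivity (\sum_(0 <= j < n) (k < v x)).
    apply: eq_bigr => j _; rewrite /upd /= ?ifF; try lia.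
  by rewrite sum_nat_const_nat subn0.
rewrite -big_distrr /= mulnC; congr (_ * _).
rewrite (big_cat_nat (leq0n (v x)) hv) /=.
rewrite (eq_big_nat _ _ (F2 := fun=> 1)); last by move=> k /andP [_ ->].
rewrite [X in _ + X](eq_big_nat _ _ (F2 := fun=> 0)); last by move=> k; lia.
by rewrite !sum_nat_const_nat; lia.
Qed.

Lemma truth_adj v a x y (i j : 'I_n) : 1 < x -> v x = i -> v y = j ->
  truth v a (EAdj x y) = G i j.
Proof.
move=> hx ei ej; rewrite /truth /EAdj.
have -> : eval (encode G) n v a (ERead (EAdd (EAdd (EConst 1) (EMulN x)) (EVar y))) =
  nth 0 (encode G) (1 + eval (encode G) n v a (EMulN x) + v y) by [].
by rewrite eval_mulN ?ei ?ej ?nth_encode ?lt0b // ltnW.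
Qed.

Lemma truth_sums v a xs0 e : truth v a (foldr ESum e xs0) <->
  exists v', [/\ forall x, x \notin xs0 -> v' x = v x,
                forall x, x \in xs0 -> v' x < n & truth v' a e].
Proof.
elim: xs0 v => [|x ys IH] v /=.
  split=> [h|[v' [h _ hv]]]; first by exists v.
  by have <- : v' = v by apply: functional_extensionality => x; apply: h.
rewrite truth_sum; split.
  move=> /existsP [k /IH [v' [h1 h2 h3]]]; exists v'; split=> // y; rewrite inE.
    rewrite negb_or => /andP [yx yys]; rewrite h1 // upd_neq //.
  case yys: (y \in ys); first by rewrite h2.
  by rewrite orbF => /eqP yx; rewrite h1 ?yys // yx upd_same.
move=> [v' [h1 h2 h3]].
have hx : v' x < n by apply: h2; rewrite inE eqxx.
apply/existsP; exists (Ordinal hx); apply/IH; exists v'; split=> // y hy.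
  rewrite /upd; case: eqP => [-> //|/eqP yx]; apply: h1.
  by rewrite inE negb_or yx.
by apply: h2; rewrite inE hy orbT.
Qed.

Section Guess.
Variables (W : finType) (H : sgraph W).
Variables (d e : W -> 'I_n) (c : W -> bool) (r s : 'I_n).

(** Colour variables run through the same range as all loop variables, so a colour is only recorded
    as being positive or not. *)
Definition represents v : Prop :=
  [/\ forall i, v (xd i) = d i, forall i, v (xe i) = e i,
      forall i, (0 < v (xc i)) = c i, v xr = r & v xs = s].

Lemma represents_upd v x k : x < 12 -> represents v -> represents (upd v x k).
Proof.
move=> hx [h1 h2 h3 h4 h5].
by split=> [i|i|i||]; rewrite upd_neq //; rewrite /xd /xe /xc /xr /xs; lia.
Qed.

Lemma truth_forced v a x g (u : 'I_n) : represents v -> v x = u ->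
  truth v a (EForced W x g) = forced G d e c u g.
Proof.
move=> [h1 h2 h3 h4 h5] hu; rewrite truth_ors has_map.
apply/hasP/existsP => -[i]; last (move=> hi; exists i; first by rewrite mem_enum).
  move=> _ hi; exists i; move: hi.
all: rewrite /= truthD !truth_and !truth_iff truth_bool truthN truth_iff !truth_eq negb_eqb /=;
  rewrite (truth_adj _ (i := d i) (j := u)) ?h1 //; [|by rewrite /xd; lia];
  by rewrite /truth /= h2 h3 hu !val_eqE.
Qed.

Lemma truth_imp v a x y al be (i j : 'I_n) : represents v -> 2 < x -> 2 < y ->
  v x = i -> v y = j ->
  truth v a (EImp W al be x y) = implication G d e c r s (i, al) (j, be).
Proof.
move=> hv hx hy ei ej; rewrite /EImp /implication /=; case: eqP => _.
  rewrite truth_and (truth_adj _ _ ei ej) 1?ltnW //; congr (_ && _); rewrite truth_sum.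
  apply: eq_existsb => t.
  have ht := represents_upd (x := 2) t isT hv.
  have et : upd v 2 t 2 = t by [].
  have ei' : upd v 2 t x = i by rewrite upd_neq //; lia.
  have ej' : upd v 2 t y = j by rewrite upd_neq //; lia.
  rewrite !truthD !truth_and !truth_neq.
  rewrite !(truth_adj _ _ et ei') // !(truth_adj _ _ et ej') // !(truth_forced _ _ ht et).
  by rewrite [eval _ _ _ _ (EVar 2)]/= [eval _ _ _ _ (EVar x)]/= [eval _ _ _ _ (EVar y)]/= et ei' ej'.
rewrite truthD !truth_and truthD truth_neq !truth_eq truth_sum (truth_forced _ _ hv ej) /=.
rewrite ei ej val_eqE; congr (_ && (_ || _) || (_ && _)).
  by case: hv => _ _ _ h4 h5; case: be; rewrite ?h4 ?h5 val_eqE.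
apply: eq_existsb => t.
have ht := represents_upd (x := 2) t isT hv.
have et : upd v 2 t 2 = t by [].
have ei' : upd v 2 t x = i by rewrite upd_neq //; lia.
have ej' : upd v 2 t y = j by rewrite upd_neq //; lia.
by rewrite !truth_and (truth_adj _ _ et ei') // (truth_adj _ _ et ej') // (truth_forced _ _ ht et).
Qed.

End Guess.

Lemma truth_embed (W : finType) (H : sgraph W) (d : W -> 'I_n) v a :
  (forall i, v (xd i) = d i) -> truth v a (EEmbed H) <-> embedding H G d.
Proof.
move=> h1; rewrite truth_ands.
have eqv i j : truth v a (EAnd (if i == j then EConst 1 else ENot (EEq (EVar (xd i)) (EVar (xd j))))
    (EIff (EBool (H i j)) (EAdj (xd i) (xd j)))) = ((i == j) || (d i != d j)) && (H i j == G (d i) (d j)).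
  rewrite truth_and truth_iff truth_bool (truth_adj _ (i := d i) (j := d j)) ?h1 //; last by rewrite /xd; lia.
  by case: eqP => //= _; rewrite truthN truth_eq /= !h1 val_eqE.
split.
  move=> /all_allpairsP h; have h' i j : ((i == j) || (d i != d j)) && (H i j == G (d i) (d j)).
    by rewrite -eqv; apply: h; rewrite mem_enum.
  split=> [i j eij|i j]; have /andP [ha /eqP hb] := h' i j; last by rewrite hb.
  by apply/eqP; move: ha; rewrite eij eqxx orbF.
move=> [dinj dG]; apply/all_allpairsP => i j _ _; rewrite eqv dG eqxx andbT.
by rewrite (inj_eq dinj); case: eqP.
Qed.

End Formulas.

(** * The decision procedure *)

Lemma downto_ind (f : nat -> state -> state) (Inv : nat -> state -> Prop) n s :
  Inv n s -> (forall k s, k < n -> Inv k.+1 s -> Inv k (f k s)) ->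
  Inv 0 (downto f n s).
Proof.
move=> hn hf; elim: n s hn hf => [|n IH] s hn hf //=.
by apply: IH; [apply: hf | move=> k s' hk; apply: hf; apply: ltnW].
Qed.

Fixpoint writes (c : cmd) : seq nat :=
  match c with
  | CSet x _ => [:: x]
  | CStore _ _ => [::]
  | CSeq c1 c2 => writes c1 ++ writes c2
  | CFor x c => x :: writes c
  end.

Lemma denote_frame w n c s x : x \notin writes c -> (denote w n c s).1 x = s.1 x.
Proof.
elim: c s => [y e|e1 e2|c1 IH1 c2 IH2|y c IH] s //=.
- by rewrite inE => h; rewrite upd_neq.
- by rewrite mem_cat negb_or => /andP [h1 h2]; rewrite IH2 ?IH1.
- rewrite inE negb_or => /andP [h1 h2].
  pose Inv (k : nat) (s' : state) := s'.1 x = s.1 x.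
  apply: (@downto_ind _ Inv) => // k s' _ h.
  by rewrite /Inv IH //= upd_neq.
Qed.

(* The literal [(x, b)] says that vertex [x] has colour [b]; it owns cell [x] if
   [b] is false and cell [n + x] if [b] is true. *)
Definition ELit (b : bool) x := if b then EAdd EN (EVar x) else EVar x.

(* Variables 3 and 4 are the ends of an implication, 5 counts rounds, 6 is the
   vertex whose two literals are compared, 7 is positive once the guess has
   failed, 8 saves the first of two reachability tests, and 9 is the answer. *)
Definition CSpread W be :=
  CStore (ELit be 4) (EAdd (ELoad (ELit be 4))
    (ESum 3 (EAdd (EAnd (ELoad (ELit false 3)) (EImp W false be 3 4))
                  (EAnd (ELoad (ELit true 3)) (EImp W true be 3 4))))).

Definition CRound W := CFor 4 (CSeq (CSpread W false) (CSpread W true)).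

Definition CClear :=
  CFor 4 (CSeq (CStore (ELit false 4) (EConst 0)) (CStore (ELit true 4) (EConst 0))).

(** There are [2 * n] literals but a loop has only [n] turns, hence two rounds per turn. *)
Definition CReach W x b :=
  CSeq CClear (CSeq (CStore (ELit b x) (EConst 1)) (CFor 5 (CSeq (CRound W) (CRound W)))).

Definition CCheck W :=
  CSeq (CReach W 6 false) (CSeq (CSet 8 (ELoad (ELit true 6)))
  (CSeq (CReach W 6 true)
        (CSet 7 (EAdd (EVar 7) (EAnd (EVar 8) (ELoad (ELit false 6))))))).

Definition CTest (W : finType) (H : sgraph W) :=
  CSeq (CSet 7 (ENot (EEmbed H)))
       (CSeq (CFor 6 (CCheck W)) (CSet 9 (EAdd (EVar 9) (ENot (EVar 7))))).

Definition CMain (W : finType) (H : sgraph W) := foldr CFor (CTest H) (guess_vars W).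

Section Commands.
Variables (n : nat) (G : sgraph 'I_n).
Local Notation dn := (denote (encode G) n).

Definition addr (l : 'I_n * bool) : nat := if l.2 then n + l.1 else l.1.
Definition marked (a : nat -> nat) l : bool := 0 < a (addr l).

Lemma addr_inj : injective addr.
Proof.
move=> [[i hi] []] [[j hj] []]; rewrite /addr /= => h; do ?lia.
- by congr (_, _); apply: val_inj => /=; lia.
- by congr (_, _); apply: val_inj.
Qed.

Lemma marked_upd a l k l' : marked (upd a (addr l) k) l' = if l' == l then 0 < k else marked a l'.
Proof. by rewrite /marked /upd (inj_eq addr_inj); case: ifP. Qed.

Lemma eval_lit (v a : nat -> nat) b x (i : 'I_n) : v x = i ->
  eval (encode G) n v a (ELit b x) = addr (i, b).
Proof. by move=> h; case: b; rewrite /addr /= h. Qed.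

Lemma truth_load (v a : nat -> nat) b x (i : 'I_n) : v x = i ->
  truth G v a (ELoad (ELit b x)) = marked a (i, b).
Proof. by move=> h; rewrite /truth [eval _ _ _ _ _]/= (eval_lit _ _ h). Qed.

Lemma marked_store be x e (st : state) (i : 'I_n) l : st.1 x = i ->
  marked (dn (CStore (ELit be x) e) st).2 l =
  if l == (i, be) then truth G st.1 st.2 e else marked st.2 l.
Proof.
move=> h; rewrite -marked_upd.
by rewrite -(eval_lit st.2 be h).
Qed.

Section Reach.
Variables (W : finType) (H : sgraph W).
Variables (d e : W -> 'I_n) (c : W -> bool) (r s : 'I_n).
Local Notation imp := (implication G d e c r s).
Local Notation represents := (represents d e c r s).

Lemma represents_ext v v' : (forall x, 12 <= x -> v' x = v x) ->
  represents v -> represents v'.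
Proof.
move=> h [h1 h2 h3 h4 h5].
by split=> [i|i|i||]; rewrite h //; rewrite /xd /xe /xc; lia.
Qed.

Lemma spread_spec be (st : state) (y : 'I_n) : represents st.1 -> st.1 4 = y ->
  (dn (CSpread W be) st).1 = st.1 /\
  forall l, marked (dn (CSpread W be) st).2 l =
    marked st.2 l || (l == (y, be)) && [exists l0, marked st.2 l0 && imp l0 (y, be)].
Proof.
move=> hr hy; split=> // l.
rewrite (marked_store _ _ _ hy); case: eqP => [->|_]; last by rewrite orbF.
rewrite truthD (truth_load _ _ hy) truth_sum; congr (_ || _) => /=.
have tk (k : 'I_n) : truth G (upd st.1 3 k) st.2 (EAdd (EAnd (ELoad (ELit false 3)) (EImp W false be 3 4))
                  (EAnd (ELoad (ELit true 3)) (EImp W true be 3 4))) =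
   marked st.2 (k, false) && imp (k, false) (y, be) || marked st.2 (k, true) && imp (k, true) (y, be).
  have e3 : upd st.1 3 k 3 = k by rewrite upd_same.
  have e4 : upd st.1 3 k 4 = y by rewrite upd_neq.
  have hr' := represents_upd (x := 3) k isT hr.
  by rewrite truthD !truth_and !(truth_load _ _ e3) !(truth_imp _ _ _ _ hr' _ _ e3 e4).
apply/existsP/existsP => [[k]|[[k []] h]].
- by rewrite tk => /orP [] h; [exists (k, false)|exists (k, true)].
- by exists k; rewrite tk h orbT.
- by exists k; rewrite tk h.
Qed.

(** Marks are updated in place, so one round may follow several implications in a row. The outcome
    is therefore only bracketed: at least one step of progress, and nothing beyond what is
    reachable. *)
Lemma round_spec st : represents st.1 ->
  [/\ represents (dn (CRound W) st).1,
      forall l, marked st.2 l -> marked (dn (CRound W) st).2 l,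
      forall l l', marked st.2 l -> imp l l' -> marked (dn (CRound W) st).2 l' &
      forall l0, (forall l, marked st.2 l -> connect imp l0 l) ->
        forall l, marked (dn (CRound W) st).2 l -> connect imp l0 l].
Proof.
move=> hr.
pose Inv k (st' : state) := [/\ represents st'.1,
  forall l, marked st.2 l -> marked st'.2 l,
  forall l (l' : 'I_n * bool), k <= l'.1 -> marked st.2 l -> imp l l' -> marked st'.2 l' &
  forall l0, (forall l, marked st.2 l -> connect imp l0 l) ->
        forall l, marked st'.2 l -> connect imp l0 l].
have [h1 h2 h3 h4] : Inv 0 (dn (CRound W) st).
  apply: downto_ind.
    by split=> // l l'; rewrite leqNgt ltn_ord.
  move=> k st1 hk [i1 i2 i3 i4].
  pose y := Ordinal hk; set st2 := (upd _ _ _, _).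
  have hr2 : represents st2.1 by apply: represents_upd i1.
  have [eq3 mk3] := spread_spec false (y := y) hr2 (upd_same _ _ _).
  change (dn (CSeq (CSpread W false) (CSpread W true)) st2) with
    (dn (CSpread W true) (dn (CSpread W false) st2)).
  set st3 := dn (CSpread W false) st2 in eq3 mk3 *.
  have hr3 : represents st3.1 by rewrite eq3.
  have y3 : st3.1 4 = y by rewrite eq3; apply: upd_same.
  have [eq4 mk4] := spread_spec true hr3 y3.
  set st4 := dn (CSpread W true) st3 in eq4 mk4 *.
  split.
  - by rewrite eq4.
  - by move=> l /i2 h; rewrite mk4 mk3 h.
  - move=> l [l' be] hl ml il; rewrite mk4 mk3.
    have [lt|ge] := ltnP k l'; first by rewrite (i3 l (l', be)).
    have -> : l' = y by apply: val_inj; apply/eqP; rewrite /= eqn_leq ge hl.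
    case: be il hl => il hl; rewrite eqxx /=.
      apply/orP; right; apply/existsP; exists l; rewrite mk3 i2 //=.
      by have <- : l' = y by apply: val_inj; apply/eqP; rewrite /= eqn_leq ge hl.
    apply/orP; left; apply/orP; right; apply/existsP; exists l; rewrite i2 //=.
    by have <- : l' = y by apply: val_inj; apply/eqP; rewrite /= eqn_leq ge hl.
  - move=> l0 hl0; have c2 := i4 _ hl0.
    have c3 l : marked st3.2 l -> connect imp l0 l.
      rewrite mk3 => /orP [/c2 //|/andP [/eqP -> /existsP [l1 /andP [/c2 h1 h2]]]].
      exact: connect_trans h1 (connect1 h2).
    move=> l; rewrite mk4 => /orP [/c3 //|/andP [/eqP -> /existsP [l1 /andP [/c3 h1 h2]]]].
    exact: connect_trans h1 (connect1 h2).
split=> // l l'; exact: h3.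
Qed.

Lemma clear_spec st l : marked (dn CClear st).2 l = false.
Proof.
pose Inv k (st' : state) := forall l : 'I_n * bool, k <= l.1 -> marked st'.2 l = false.
have h : Inv 0 (dn CClear st); last exact: h.
apply: downto_ind; first by move=> l'; rewrite leqNgt ltn_ord.
move=> k st1 hk i1 [l' be] hl; set st2 := (upd _ _ _, _).
have h4 : st2.1 4 = Ordinal hk by apply: upd_same.
change (dn (CSeq (CStore (ELit false 4) (EConst 0)) (CStore (ELit true 4) (EConst 0))) st2)
  with (dn (CStore (ELit true 4) (EConst 0)) (dn (CStore (ELit false 4) (EConst 0)) st2)).
rewrite (marked_store (st := dn (CStore (ELit false 4) (EConst 0)) st2) _ _ _ h4).
rewrite (marked_store _ _ _ h4) /truth /=.
have [lt|ge] := ltnP k l'; first by do 2 (case: ifP => // _); apply: i1.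
have -> : l' = Ordinal hk by apply: val_inj; apply/eqP; rewrite /= eqn_leq ge hl.
by case: be {hl}; rewrite ?eqxx //=; case: ifP.
Qed.

Lemma reach_spec x b (st : state) (i : 'I_n) : x != 4 -> x != 5 -> represents st.1 -> st.1 x = i ->
  forall l, marked (dn (CReach W x b) st).2 l = connect imp (i, b) l.
Proof.
move=> x4 x5 hr hx l.
have h1 := clear_spec st; have k1 := denote_frame (encode G) n (c := CClear) st.
change (dn (CReach W x b) st) with
  (dn (CFor 5 (CSeq (CRound W) (CRound W))) (dn (CStore (ELit b x) (EConst 1)) (dn CClear st))).
set st1 := dn CClear st in h1 k1 *.
have hx1 : st1.1 x = i by rewrite k1 ?hx // !inE.
have hr1 : represents st1.1 by apply: represents_ext hr => y hy; apply: k1; rewrite !inE; lia.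
set st2 := dn (CStore _ _) st1.
have m2 l' : marked st2.2 l' = (l' == (i, b)).
  by rewrite (marked_store _ _ _ hx1) h1; case: eqP.
pose Inv k (st' : state) := [/\ represents st'.1,
  forall p, path imp (i, b) p -> size p <= 2 * (n - k) -> marked st'.2 (last (i, b) p) &
  forall l', marked st'.2 l' -> connect imp (i, b) l'].
have [_ h2 h3] : Inv 0 (dn (CFor 5 (CSeq (CRound W) (CRound W))) st2).
  apply: downto_ind.
    split=> // [p _|l']; last by rewrite m2 => /eqP ->; apply: connect0.
    by rewrite subnn muln0 leqn0 size_eq0 => /eqP ->; rewrite m2 /=.
  move=> k st3 hk [i1 i2 i3]; set st4 := (upd _ _ _, _).
  have hr4 : represents st4.1 by apply: represents_upd i1.
  change (dn (CSeq (CRound W) (CRound W)) st4) with (dn (CRound W) (dn (CRound W) st4)).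
  have [hr5 mono5 prog5 sound5] := round_spec hr4.
  have [hr6 mono6 prog6 sound6] := round_spec hr5.
  split=> //; last by apply: sound6; apply: sound5; apply: i3.
  move=> p; have [lt|ge] := leqP (size p) (2 * (n - k.+1)).
    by move=> hp _; apply: mono6; apply: mono5; apply: i2.
  (* The path exceeds what the earlier turns cover by one or two edges; they are split off its end,
     and each takes one of the two rounds. *)
  elim/last_ind: p ge => [|p z _]; first by rewrite ltn0.
  rewrite size_rcons rcons_path last_rcons => ge /andP [hp pz] le.
  have [lt|ge'] := leqP (size p) (2 * (n - k.+1)).
    by apply: mono6; apply: prog5 pz; apply: i2.
  elim/last_ind: p ge' ge hp pz le => [|p z' _]; first by rewrite ltn0.
  rewrite size_rcons rcons_path last_rcons => ge' _ /andP [hp pz] zz le.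
  apply: prog6 zz; apply: prog5 pz; apply: i2 => //; lia.
apply/idP/idP; first exact: h3.
(* A path without repetition visits at most [2 * n] literals, so it has fewer than [2 * n] edges. *)
move=> /connectP [p hp ->]; case: (shortenP hp) => p' hp' up' _.
apply: h2 => //; have := max_card (mem ((i, b) :: p')).
by rewrite (card_uniqP up') card_prod card_ord card_bool /=; lia.
Qed.

Definition unsolvable_at (i : 'I_n) : bool :=
  connect imp (i, false) (i, true) && connect imp (i, true) (i, false).

Lemma check_spec (st : state) (i : 'I_n) : represents st.1 -> st.1 6 = i ->
  (0 < (dn (CCheck W) st).1 7) = (0 < st.1 7) || unsolvable_at i.
Proof.
move=> hr h6.
have m1 := reach_spec (x := 6) false isT isT hr h6.
have k1 := denote_frame (encode G) n (c := CReach W 6 false) st.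
pose st1 := dn (CReach W 6 false) st; rewrite -/st1 in m1 k1.
pose st2 := dn (CSet 8 (ELoad (ELit true 6))) st1.
have h61 : st1.1 6 = i by rewrite k1.
have e8 : (0 < st2.1 8) = connect imp (i, false) (i, true).
  by rewrite /st2 /= upd_same -m1 -(truth_load _ _ h61).
have h62 : st2.1 6 = i by rewrite -h61.
have hr1 : represents st1.1 by apply: represents_ext hr => y hy; apply: k1; rewrite !inE; lia.
have hr2 : represents st2.1 by apply: represents_upd hr1.
have m3 := reach_spec (x := 6) true isT isT hr2 h62.
have k3 := denote_frame (encode G) n (c := CReach W 6 true) st2.
pose st3 := dn (CReach W 6 true) st2; rewrite -/st3 in m3 k3.
have -> : dn (CCheck W) st = dn (CSet 7 (EAdd (EVar 7) (EAnd (EVar 8) (ELoad (ELit false 6))))) st3 by [].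
rewrite [(denote _ _ _ _).1]/= upd_same.
rewrite -[0 < _]/(truth G st3.1 st3.2 (EAdd (EVar 7) (EAnd (EVar 8) (ELoad (ELit false 6))))).
have h63 : st3.1 6 = i by rewrite k3.
rewrite truthD truth_and (truth_load _ _ h63) m3.
have -> : truth G st3.1 st3.2 (EVar 8) = (0 < st2.1 8) by rewrite /truth /= k3.
have -> : truth G st3.1 st3.2 (EVar 7) = (0 < st.1 7).
  by rewrite /truth /= k3 // /st2 /= upd_neq // k1.
by rewrite e8.
Qed.

Lemma check_all_spec st : represents st.1 ->
  (0 < (dn (CFor 6 (CCheck W)) st).1 7) = (0 < st.1 7) || [exists i, unsolvable_at i].
Proof.
move=> hr.
pose Inv k (st' : state) := represents st'.1 /\
  (0 < st'.1 7) = (0 < st.1 7) || [exists i : 'I_n, (k <= i) && unsolvable_at i].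
have [_ ->] : Inv 0 (dn (CFor 6 (CCheck W)) st).
  apply: downto_ind.
    split=> //; rewrite [X in _ || X](_ : _ = false) ?orbF //.
    by apply/existsP => -[i]; rewrite leqNgt ltn_ord.
  move=> k st1 hk [i1 i2]; set st2 := (upd _ _ _, _).
  have hr2 : represents st2.1 by apply: represents_upd i1.
  have h6 : st2.1 6 = Ordinal hk by apply: upd_same.
  have k2 := denote_frame (encode G) n (c := CCheck W) st2.
  split; first by apply: represents_ext hr2 => y hy; apply: k2; rewrite !inE; lia.
  rewrite (check_spec hr2 h6) /st2 /= upd_neq // i2 -orbA; congr (_ || _).
  apply/orP/existsP => [[/existsP [i /andP [h1 h2]]|h]|[i /andP [h1 h2]]].
  - by exists i; rewrite h2 ltnW.
  - by exists (Ordinal hk); rewrite /= leqnn.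
  - have [lt|ge] := ltnP k i; first by left; apply/existsP; exists i; rewrite lt.
    by right; have <- : i = Ordinal hk by apply: val_inj; apply/eqP; rewrite /= eqn_leq ge.
by congr (_ || _); apply: eq_existsb.
Qed.

Lemma test_spec st : represents st.1 ->
  0 < (dn (CTest H) st).1 9 <->
  0 < st.1 9 \/ embedding H G d /\ solvable2 G d e c r s.
Proof.
move=> hr.
pose st1 := dn (CSet 7 (ENot (EEmbed H))) st.
have hr1 : represents st1.1 by apply: represents_upd hr.
have e7 : (0 < st1.1 7) = ~~ truth G st.1 st.2 (EEmbed H) by rewrite -truthN /st1 /= upd_same.
have e7' := check_all_spec hr1.
have k2 := denote_frame (encode G) n (c := CFor 6 (CCheck W)) st1.
pose st2 := dn (CFor 6 (CCheck W)) st1; rewrite -/st2 in e7' k2.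
have -> : dn (CTest H) st = dn (CSet 9 (EAdd (EVar 9) (ENot (EVar 7)))) st2 by [].
rewrite [(denote _ _ _ _).1]/= upd_same.
rewrite -[0 < _]/(truth G st2.1 st2.2 (EAdd (EVar 9) (ENot (EVar 7)))) truthD truthN.
have -> : truth G st2.1 st2.2 (EVar 7) = (0 < st2.1 7) by [].
have -> : truth G st2.1 st2.2 (EVar 9) = (0 < st.1 9) by rewrite /truth /= k2.
have -> : ~~ (0 < st2.1 7) = truth G st.1 st.2 (EEmbed H) && solvable2 G d e c r s.
  by rewrite e7' e7 negb_or negbK negb_exists.
have [hd _ _ _ _] := hr; have hemb := truth_embed G H st.2 hd.
split=> [/orP [|/andP [/hemb h1 h2]]|[->|[h1 ->]]]; [by left|by right|by []|].
by rewrite (introT idP (hemb.2 h1)) orbT.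
Qed.

End Reach.

Lemma writes_fors c ps : writes (foldr CFor c ps) = ps ++ writes c.
Proof. by elim: ps => //= p ps ->. Qed.

(** Loops around a test that accumulates its successes in variable 9 act as an existential
    quantifier. In the induction [PS] stays the full list, while [ps] holds the loops still to be
    entered. [Q] may look at [PS] only, because the rest of the state changes from one test to the
    next. *)
Lemma fors_spec c (PS : seq nat) (Q : (nat -> nat) -> Prop) :
  9 \notin PS -> {in PS, forall x, x \notin writes c} ->
  (forall v v', {in PS, v =1 v'} -> Q v -> Q v') ->
  (forall st : state, {in PS, forall x, st.1 x < n} ->
     0 < (dn c st).1 9 <-> 0 < st.1 9 \/ Q st.1) ->
  forall ps (st : state), {subset ps <= PS} ->
  {in PS, forall x, x \notin ps -> st.1 x < n} ->
  0 < (dn (foldr CFor c ps) st).1 9 <->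
  0 < st.1 9 \/ exists v, [/\ {in PS, forall x, x \notin ps -> v x = st.1 x},
                            {in ps, forall x, v x < n} & Q v].
Proof.
move=> h9 hw hQ hc; elim=> [|p ps IH] st hsub hst /=.
  rewrite hc; last by move=> x hx; apply: hst.
  split=> -[]; do ?[by left]; first by move=> q; right; exists st.1; split.
  move=> [v [h1 _ q]]; right; apply: hQ q => x hx; exact: h1.
pose R j := exists v, [/\ {in PS, forall x, x \notin ps -> v x = upd st.1 p j x},
                        {in ps, forall x, v x < n} & Q v].
pose Inv k (st' : state) := {in PS, forall x, x \notin p :: ps -> st'.1 x = st.1 x} /\
  (0 < st'.1 9 <-> 0 < st.1 9 \/ exists j, k <= j < n /\ R j).
have hpPS : p \in PS by apply: hsub; rewrite inE eqxx.
have p9 : 9 != p by apply: contraNneq h9 => ->.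
have [_ ->] : Inv 0 (dn (CFor p (foldr CFor c ps)) st).
  apply: downto_ind.
    split=> //; split=> [h|[//|[j [hj _]]]]; first by left.
    by lia.
  move=> k st1 hk [i1 i2]; set st2 := (upd _ _ _, _).
  have k3 := denote_frame (encode G) n (c := foldr CFor c ps) st2.
  have e2 : {in PS, forall x, x \notin ps -> st2.1 x = upd st.1 p k x}.
    move=> x hx hxps; rewrite /st2 /= /upd; case: eqP => // /eqP xp.
    by rewrite i1 // inE negb_or xp.
  split.
    move=> x hx; rewrite inE negb_or => /andP [xp xps]; rewrite k3 ?e2 ?upd_neq //.
    by rewrite writes_fors mem_cat negb_or xps hw.
  rewrite IH; first last.
  - move=> x hx hxp; rewrite e2 // /upd; case: eqP => // /eqP xp.
    by apply: hst; rewrite // inE negb_or xp.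
  - by move=> x hx; apply: hsub; rewrite inE hx orbT.
  have -> : (exists v, [/\ {in PS, forall x, x \notin ps -> v x = st2.1 x},
      {in ps, forall x, v x < n} & Q v]) <-> R k.
    by split=> -[v [h1 h2 h3]]; exists v; split=> // x hx hxps; rewrite h1 // e2.
  rewrite /st2 /= upd_neq // i2; split.
    move=> [[|[j [hj rj]]]|rk]; [by left|right; exists j|right; exists k].
      by split=> //; lia.
    by rewrite leqnn hk.
  move=> [|[j [hj rj]]]; first by do 2 left.
  have [lt|ge] := ltnP k j; first by left; right; exists j; split=> //; lia.
  by right; have -> : k = j by lia.
split=> -[]; do ?[by left].
  move=> [j [/andP [_ hj] [v [h1 h2 h3]]]]; right; exists v; split=> //.
    by move=> x hx; rewrite inE negb_or => /andP [xp xps]; rewrite h1 // upd_neq.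
  move=> x; rewrite inE; case xps: (x \in ps); first by rewrite h2.
  by rewrite orbF => /eqP xp; rewrite xp in xps *; rewrite h1 ?xps // upd_same.
move=> [v [h1 h2 h3]]; right; exists (v p); split.
  by apply: h2; rewrite inE eqxx.
exists v; split=> // x hx; last by apply: h2; rewrite inE hx orbT.
move=> xps; rewrite /upd; case: eqP => [-> //|/eqP xp].
by rewrite h1 // inE negb_or xp.
Qed.

Lemma guess_vars_ge (W : finType) x : x \in guess_vars W -> 12 <= x.
Proof.
rewrite !inE !mem_cat.
by move=> /or4P [/eqP ->|/eqP ->|/mapP [i _ ->]|/orP [] /mapP [i _ ->]];
  rewrite ?/xd ?/xe ?/xc //; lia.
Qed.

Lemma mem_guess_vars (W : finType) (i : W) :
  [/\ xd i \in guess_vars W, xe i \in guess_vars W & xc i \in guess_vars W].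
Proof. by split; rewrite !inE !mem_cat map_f ?mem_enum ?orbT. Qed.

Definition good_guess (W : finType) (H : sgraph W) (v : nat -> nat) : Prop :=
  exists (d e : W -> 'I_n) (c : W -> bool) (r s : 'I_n),
  [/\ represents d e c r s v, embedding H G d & solvable2 G d e c r s].

Lemma main_spec (W : finType) (H : sgraph W) (st : state) : st.1 9 = 0 ->
  0 < (dn (CMain H) st).1 9 <->
  exists2 v, {in guess_vars W, forall x, v x < n} & good_guess H v.
Proof.
move=> h9; rewrite (@fors_spec _ (guess_vars W) (good_guess H)).
- rewrite h9; split=> [[//|[v [_ h2 h3]]]|[v h1 h2]]; first by exists v.
  by right; exists v; split=> // x ->.
- by apply: contraTN isT => /guess_vars_ge.
- by move=> x /guess_vars_ge h; rewrite !inE; lia.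
- move=> v v' hv [d [e [c [r [s [[h1 h2 h3 h4 h5] hd hs]]]]]].
  exists d, e, c, r, s; split=> //; split=> [i|i|i||]; rewrite -hv //;
  by have [] := mem_guess_vars i.
- move=> st' hst.
  have rep : exists (d e : W -> 'I_n) (c : W -> bool) (r s : 'I_n), represents d e c r s st'.1.
    have bd i := let: And3 h _ _ := mem_guess_vars i in hst _ h.
    have be i := let: And3 _ h _ := mem_guess_vars i in hst _ h.
    have br : st'.1 xr < n by apply: hst.
    have bs : st'.1 xs < n by apply: hst.
    by exists (fun i => Ordinal (bd i)), (fun i => Ordinal (be i)),
      (fun i => 0 < st'.1 (xc i)), (Ordinal br), (Ordinal bs).
  split=> [|[h|]].
  + have [d [e [c [r [s hr]]]]] := rep.
    move=> /(test_spec H hr) [|[h1 h2]]; [by left|right].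
    by exists d, e, c, r, s.
  + have [d [e [c [r [s hr]]]]] := rep.
    by apply/(test_spec H hr); left.
  + move=> [d [e [c [r [s [hr h1 h2]]]]]].
    by apply/(test_spec H hr); right.
- by [].
- by move=> x ->.
Qed.

(** With [1 < n] both colours, coded as 0 and 1, occur among the values of a loop variable. *)
Lemma ex_represents (W : finType) (d e : W -> 'I_n) (c : W -> bool) (r s : 'I_n) :
  1 < n ->
  exists2 v, represents d e c r s v & {in guess_vars W, forall x, v x < n}.
Proof.
move=> n2.
pose v x := if x == xr then val r else if x == xs then val s else
  if [pick i | x == xd i] is Some i then val (d i) else
  if [pick i | x == xe i] is Some i then val (e i) else
  if [pick i | x == xc i] is Some i then nat_of_bool (c i) else 0.
exists v; last first.
  move=> x _; rewrite /v; do ![case: ifP => _; first exact: ltn_ord].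
  case: pickP => [i _|_]; first exact: ltn_ord.
  case: pickP => [i _|_]; first exact: ltn_ord.
  case: pickP => [i _|_]; last exact: ltnW.
  by apply: leq_ltn_trans n2; case: (c i).
have rank_eq (i j : W) : enum_rank i = enum_rank j :> nat -> i = j.
  by move=> h; apply: enum_rank_inj; apply: val_inj.
split=> //; rewrite /v.
- move=> i; rewrite !ifF; try by rewrite /xd /xr /xs; lia.
  case: pickP => [j /eqP h|/(_ i)]; last by rewrite eqxx.
  by have -> : i = j by apply: rank_eq; move: h; rewrite /xd; lia.
- move=> i; rewrite !ifF; try by rewrite /xe /xr /xs; lia.
  case: pickP => [j /eqP h|_]; first by move: h; rewrite /xe /xd; lia.
  case: pickP => [j /eqP h|/(_ i)]; last by rewrite eqxx.
  by have -> : i = j by apply: rank_eq; move: h; rewrite /xe; lia.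
- move=> i; rewrite !ifF; try by rewrite /xc /xr /xs; lia.
  case: pickP => [j /eqP h|_]; first by move: h; rewrite /xc /xd; lia.
  case: pickP => [j /eqP h|_]; first by move: h; rewrite /xc /xe; lia.
  case: pickP => [j /eqP h|/(_ i)]; last by rewrite eqxx.
  by rewrite lt0b; have -> : i = j by apply: rank_eq; move: h; rewrite /xc; lia.
Qed.

Lemma main_correct (W : finType) (H : sgraph W) (st : state) :
  induced_free (dunion H (path_graph 3)) G -> (exists d, embedding H G d) ->
  st.1 9 = 0 -> (0 < (dn (CMain H) st).1 9) = has_matching_cut G.
Proof.
move=> hfree [d0 hd0] h9; apply/idP/idP.
  move=> /(main_spec H h9) [v _ [d [e [c [r [s [_ hd hs]]]]]]].
  by apply/has_matching_cutP; apply: solvable_cut hd hfree hs.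
move=> /has_matching_cutP [f hf].
have n2 : 1 < n.
  case: hf => [[x [y nxy]] _]; have := ltn_ord x; have := ltn_ord y.
  by have : x != y :> nat; [apply: contraNneq nxy => /val_inj -> | lia].
have [e [c [r [s hs]]]] := cut_solvable d0 hf.
have [v hv bv] := ex_represents d0 e c r s n2.
by apply/(main_spec H h9); exists v => //; exists d0, e, c, r, s.
Qed.

Lemma search_correct (W : finType) (H : sgraph W) v a :
  truth G v a (foldr ESum (EEmbed H) [seq xd i | i <- enum W]) <->
  exists d, embedding H G d.
Proof.
rewrite truth_sums; split.
  move=> [v' [_ hv ht]].
  have bd (i : W) : v' (xd i) < n by apply: hv; apply: map_f; rewrite mem_enum.
  by exists (fun i => Ordinal (bd i)); move: ht => /(truth_embed G H a (d := fun i => Ordinal (bd i))); apply.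
move=> [d hd].
pose v' x := if [pick i | x == xd i] is Some i then val (d i) else v x.
have v'd (i : W) : v' (xd i) = d i.
  rewrite /v'; case: pickP => [j /eqP h|/(_ i)]; last by rewrite eqxx.
  have -> // : i = j; apply: enum_rank_inj; apply: val_inj; move: h; rewrite /xd /=; lia.
exists v'; split.
- move=> x hx; rewrite /v'; case: pickP => [j /eqP h|//].
  by case/negP: hx; rewrite h; apply: map_f; rewrite mem_enum.
- by move=> x /mapP [i _ ->]; rewrite v'd.
- exact/(truth_embed G H a v'd).
Qed.

End Commands.

(** * The RAM program *)

Lemma foldl_clear w rs m r :
  foldl (fun m i => effect w i m) m [seq IConst r 0 | r <- rs] r =
  if r \in rs then 0 else m r.
Proof.
elim: rs m => //= r' rs IH m; rewrite IH /effect /= inE /upd.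
by case: eqP => //= _; case: ifP.
Qed.

(** The input has [n * n + 1] entries, so a polynomial in the number of vertices is bounded by one
    in the input length. *)
Lemma poly_bounded_encode f c k : poly_bounded f -> exists c' k', forall n (G : sgraph 'I_n),
  f n + (c * size (encode G) ^ k + c) <= c' * size (encode G) ^ k' + c'.
Proof.
move=> [c1 [k1 h1]]; exists (c1 * 2 ^ k1 + c), (k1 + k) => n G.
have s0 : 0 < size (encode G) by rewrite size_encode.
have hn : n.+1 <= 2 * size (encode G) by rewrite size_encode; nia.
set z := size _ in s0 hn *.
have h2 : f n <= c1 * 2 ^ k1 * z ^ (k1 + k).
  apply: leq_trans (h1 n) _; rewrite -mulnA leq_mul2l; apply/orP; right.
  apply: (@leq_trans ((2 * z) ^ k1)); first by case: k1 {h1} => // k1; rewrite leq_exp2r.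
  by rewrite expnMn leq_mul2l leq_pexp2l ?leq_addr ?orbT.
have h3 : c * z ^ k <= c * z ^ (k1 + k) by rewrite leq_mul2l leq_pexp2l ?leq_addl ?orbT.
by rewrite mulnDl; lia.
Qed.

Section Program.
Variables (W : finType) (H : sgraph W) (P : program).

(** An expression rather than a command: its evaluation restores the variables and writes no cell,
    so only scratch registers need clearing before the given program runs. *)
Definition ESearch := foldr ESum (EEmbed H) [seq xd i | i <- enum W].

Definition search_code := compe ESearch 0 2.
Definition solve_code := compc (CMain H) 0 (4 + size search_code).

Definition used_registers := rN :: rOne :: [seq scr j | j <- iota 0 (width ESearch)].

Definition clear_code := [seq IConst r 0 | r <- used_registers].

(** Registers start at 0, so [IRead rN rN] fetches entry 0 of the input, which is [n]. The
    subtraction makes the jump fire exactly when no copy is found; it leads to [clear_code], from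
    which execution falls into the relocated program. As [rN] is register 0, it also receives the
    answer of the solver. *)
Definition prologue : program :=
  [:: IRead rN rN; IConst rOne 1] ++ search_code ++
  [:: ISub (scr 0) rOne (scr 0)] ++
  [:: IJumpPos (scr 0) (6 + size search_code + size solve_code)] ++ solve_code ++
  [:: mov rN (var 9)] ++ [:: IHalt] ++ clear_code.

Definition full_program : program := prologue ++ relocate (size prologue) P.

Definition prologue_cost n :=
  cost ESearch n + costc (CMain H) n + (7 + width ESearch).

Lemma size_prologue :
  size prologue = 6 + size search_code + size solve_code + size clear_code.
Proof. by rewrite !size_cat /= !addnA; lia. Qed.

Lemma full_program_code :
  [/\ code_at full_program 0 [:: IRead rN rN; IConst rOne 1],
      code_at full_program 2 search_code,
      code_at full_program (2 + size search_code) [:: ISub (scr 0) rOne (scr 0)] &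
      nth IHalt full_program (3 + size search_code) =
        IJumpPos (scr 0) (6 + size search_code + size solve_code)] /\
  [/\ code_at full_program (4 + size search_code) solve_code,
      code_at full_program (4 + size search_code + size solve_code) [:: mov rN (var 9)],
      nth IHalt full_program (5 + size search_code + size solve_code) = IHalt &
      code_at full_program (6 + size search_code + size solve_code) clear_code].
Proof.
have h : code_at full_program 0 prologue by exact: (@code_at_mid [::]).
move: h; rewrite /prologue.
move: full_program search_code solve_code clear_code => F sc so cl h.
have {h} [h1 h] := code_at_cat h.
have {h} [h2 h] := code_at_cat h.
have {h} [h3 h] := code_at_cat h.
have {h} [h4 h] := code_at_cons h.
have {h} [h5 h] := code_at_cat h.
have {h} [h6 h] := code_at_cat h.
have {h} [h7 h8] := code_at_cons h.
rewrite !add0n /= in h1 h2 h3 h4 h5 h6 h7 h8.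
have e3 : 2 + size sc + 1 = 3 + size sc by lia.
rewrite e3 in h4 h5 h6 h7 h8.
have e7 : (3 + size sc).+1 + size so + 1 = 5 + size sc + size so by lia.
rewrite e7 in h7 h8.
by split; split; [exact: h1|exact: h2|exact: h3|exact: h4|exact: h5|exact: h6|exact: h7|exact: h8].
Qed.

Section Run.
Variables (n : nat) (G : sgraph 'I_n).
Local Notation w := (encode G).

Definition start : memory := upd (upd (fun=> 0) rN n) rOne 1.

Lemma run_search : exists m,
  [/\ reaches full_program w (cost ESearch n + 3) (0, fun=> 0)
        (3 + size search_code, upd m (scr 0) (m rOne - m (scr 0))),
      m (scr 0) = eval w n (vars start) (cells start) ESearch &
      agree 0 (width ESearch) start m].
Proof.
have [[h1 h2 h3 _] _] := full_program_code.
have r1 := reaches_straight w (fun=> 0) h1 isT.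
have [||m [r2 e2 a2]] := compe_correct (m := start) w h2; [by []|by []|].
exists m; split=> //.
have r3 := reaches_straight w m h3 isT.
have := reaches_trans r1 (reaches_trans r2 r3).
have -> : 2 + size search_code + size [:: ISub (scr 0) rOne (scr 0)] = 3 + size search_code.
  by rewrite -[size [:: _]]/1; lia.
by apply: reaches_le; change (2 + (cost ESearch n + 1) <= cost ESearch n + 3); lia.
Qed.

Lemma run_solve : induced_free (dunion H (path_graph 3)) G ->
  (exists d, embedding H G d) ->
  exists2 t, t <= prologue_cost n & answers full_program w t (has_matching_cut G).
Proof.
move=> hfree hemb; have [m [r1 e1 a1]] := run_search.
have [[_ _ _ h4] [h5 h6 h7 _]] := full_program_code.
have [aN aO aZ] := agree_base a1.
have pos : 0 < m (scr 0) by rewrite e1; apply/(search_correct G H).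
pose m1 := upd m (scr 0) (m rOne - m (scr 0)).
have a2 : agree 0 (width ESearch) start m1.
  by apply: agree_upd a1; rewrite width_gt0.
have [bN bO bZ] := agree_base a2.
have jm : m1 (scr 0) = 0 by rewrite /m1 upd_same aO /start upd_same; lia.
have := reaches_jump w m1 h4; rewrite jm ltnn => r2; rewrite -/m1 in r1.
have [||m2 [r3 s3 [kN kO kZ _]]] := compc_correct (m := m1) w h5; [by rewrite bO|by rewrite bZ|].
have r4 := reaches_straight w m2 h6 isT.
have [t ht et] := reaches_trans r1 (reaches_trans r2 (reaches_trans r3 r4)).
exists t.
  apply: leq_trans ht _; rewrite bN /prologue_cost.
  by change (cost ESearch n + 3 + (1 + (costc (CMain H) n + 1)) <=
    cost ESearch n + costc (CMain H) n + (7 + width ESearch)); lia.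
rewrite /answers /halted /run et /fetch; split.
  by rewrite -[in RHS]h7 /=; congr nth; lia.
rewrite /= /effect /= upd_same kZ bZ addn0.
have -> : m2 (var 9) = (state_of m2).1 9 by [].
rewrite s3 bN; apply: main_correct => //.
by rewrite /= (agree_vars a2).
Qed.

Lemma run_delegate t b : ~ (exists d, embedding H G d) -> answers P w t b ->
  exists2 t', t' <= prologue_cost n + t & answers full_program w t' b.
Proof.
move=> hemb [hhalt hans]; have [m [r1 e1 a1]] := run_search.
have [[_ _ _ h4] [_ _ _ h8]] := full_program_code.
have [aN aO aZ] := agree_base a1.
have zero : m (scr 0) = 0.
  by apply/eqP; rewrite -leqn0 leqNgt e1; apply/negP => /(search_correct G H).
pose m1 := upd m (scr 0) (m rOne - m (scr 0)).
have a2 : agree 0 (width ESearch) start m1.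
  by apply: agree_upd a1; rewrite width_gt0.
have jm : m1 (scr 0) = 1 by rewrite /m1 upd_same aO zero.
have := reaches_jump w m1 h4; rewrite jm ltnSn => r2; rewrite -/m1 in r1.
have straight_clear : all straight clear_code by rewrite all_map; apply/allP.
have r3 := reaches_straight w m1 h8 straight_clear.
have [t1 ht1 et1] := reaches_trans r1 (reaches_trans r2 r3).
(* Outside the cleared registers the memory agrees with [start], which is 0 there, so the given
   program meets its expected initial memory. *)
have clear0 : foldl (fun m i => effect w i m) m1 clear_code = fun=> 0.
  apply: functional_extensionality => r; rewrite foldl_clear; case: ifPn => // hr.
  move: hr; rewrite !inE !negb_or => /and3P [rN' rO' rs].
  rewrite a2 /start ?upd_neq // => j hj; apply: contraNneq rs => ->.
  by apply: map_f; rewrite mem_iota.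
rewrite clear0 -size_prologue in et1.
exists (t + t1).
  rewrite [_ + t]addnC leq_add2l; apply: leq_trans ht1 _.
  by rewrite /prologue_cost size_map /= size_map size_iota; lia.
have er : run full_program w (t + t1) = (size prologue + (run P w t).1, (run P w t).2).
  by rewrite /run iterD et1 iter_relocate.
rewrite /answers er; split=> //.
rewrite /halted fetch_relocate; move: hhalt; rewrite /halted.
by case: (run P w t) => pc m' ->.
Qed.

End Run.

Lemma poly_bounded_prologue : poly_bounded prologue_cost.
Proof.
apply: poly_boundedD (poly_bounded_const _).
exact: poly_boundedD (poly_bounded_cost _) (poly_bounded_costc _).
Qed.

End Program.

Theorem theorem4 (W : finType) (H : sgraph W) :
  matching_cut_poly_time (free_class H) ->
  matching_cut_poly_time (free_class (dunion H (path_graph 3))).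
Proof.
move=> [P [c [k hP]]].
have [c' [k' hb]] := poly_bounded_encode c k (poly_bounded_prologue H).
exists (full_program H P), c', k' => n G hconn hfree.
have hle t : t <= prologue_cost H n + (c * size (encode G) ^ k + c) ->
  t <= c' * size (encode G) ^ k' + c' by move=> h; apply: leq_trans (hb n G).
(* The value of the search formula, a boolean, makes the case distinction on containing [H]
   constructive. *)
have [/(search_correct G H (fun=> 0) (fun=> 0)) hemb|hno] :=
  boolP (truth G (fun=> 0) (fun=> 0) (ESearch H)).
  have [t ht hans] := run_solve P hfree hemb; exists t; split=> //.
  by apply: hle; apply: leq_trans ht (leq_addr _ _).
have hemb : ~ exists d, embedding H G d.
  by move=> /(search_correct G H (fun=> 0) (fun=> 0)); rewrite -/(ESearch H) (negbTE hno).
have [|t [ht hans]] := hP n G hconn; first exact/induced_freePn.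
have [t' ht' hans'] := run_delegate hemb hans; exists t'; split=> //.
by apply: hle; apply: leq_trans ht' _; rewrite leq_add2l.
Qed.
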